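(* Tropical elliptic curves from regular unimodular triangulations of the Cayley polytope $C(2\Delta_3,2\Delta_3)$ achieve all possible cycle lengths (between $3$ and $16$): for every integer $n$ with $3\le n\le 16$ there exists a regular unimodular triangulation $T$ of $C(2\Delta_3,2\Delta_3)$ such that the unique cycle of the associated tropical elliptic curve $G(T)$ has length $n$.
   Context: Let $\mathbf{e}_1,\mathbf{e}_2,\mathbf{e}_3$ be the standard basis of $\mathbb{R}^3$ and $2\Delta_3 := \mathrm{conv}\{\mathbf{0}, 2\mathbf{e}_1, 2\mathbf{e}_2, 2\mathbf{e}_3\} \subset \mathbb{R}^3$; it contains $10$ lattice points. Writing also $\mathbf{e}_1,\mathbf{e}_2$ for the standard basis of $\mathbb{R}^2$, the Cayley polytope is $$C(2\Delta_3,2\Delta_3) := \mathrm{conv}\big(\{\mathbf{e}_1\}\times 2\Delta_3 \;\cup\; \{\mathbf{e}_2\}\times 2\Delta_3\big) \subset \mathbb{R}^2\times\mathbb{R}^3=\mathbb{R}^5 .$$ It is a $4$-dimensional polytope (isomorphic to $2\Delta_3\times\Delta_1$) with $8$ vertices and $20$ lattice points: $10$ in $\{\mathbf{e}_1\}\times 2\Delta_3$ and $10$ in $\{\mathbf{e}_2\}\times 2\Delta_3$. Triangulations are triangulations of the polytope whose vertices are among its lattice points. A triangulation is regular if it is induced by a height (weight) function on the $20$ lattice points, i.e. its maximal cells are the projections of the lower facets of the convex hull of the lifted points. It is unimodular if every maximal simplex has normalized lattice volume $1$ with respect to the lattice $\mathbb{Z}^5\cap \mathrm{aff}\,C(2\Delta_3,2\Delta_3)$;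 since the polytope has normalized volume $32$, such a triangulation has exactly $32$ maximal simplices. The tropical elliptic curve $G(T)$ of a regular unimodular triangulation $T$: slicing $T$ with $\{x_1=x_2=1/2\}$ (and scaling by $2$) gives a mixed subdivision of the Minkowski sum $2\Delta_3+2\Delta_3=4\Delta_3$ whose maximal cells are $Q_1+Q_2$, where the maximal simplex of $T$ being sliced is $\mathrm{conv}(\{\mathbf{e}_1\}\times Q_1\cup\{\mathbf{e}_2\}\times Q_2)$ and $\dim Q_1+\dim Q_2=3$. A cell is mixed if $\dim Q_1,\dim Q_2>0$; then one of $Q_1,Q_2$ is a segment and the other a triangle, and the cell is a triangular prism. The graph $G(T)$ has one vertex for each mixed cell and one edge for each pair of mixed cells sharing a common quadrilateral facet. Equivalently: the vertices of $G(T)$ are the maximal simplices of $T$ having $2$ or $3$ of their $5$ vertices in $\{\mathbf{e}_1\}\times 2\Delta_3$, and two of them are joined by an edge when they share a common facet having exactly $2$ vertices in each of the two copies of $2\Delta_3$. This is a connected graph of genus $1$ with $16$ vertices and $16$ edges, so it contains a unique cycle; the cycle length is the number of edges of that cycle. (The tropical curve also has $16$ unbounded rays, which are suppressed.) *)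

(* Defs.v *)
From HB Require Import structures.
From mathcomp Require Import all_boot all_order all_algebra finmap.
From mathcomp Require Import boolp classical_sets reals.

Set Implicit Arguments.
Unset Strict Implicit.
Unset Printing Implicit Defensive.

Import Order.TTheory GRing.Theory Num.Theory.

Local Open Scope classical_set_scope.
Local Open Scope ring_scope.

Section Polytopes.
Context {R : realType}.

Definition conv {n} (A : set 'rV[R]_n) : set 'rV[R]_n :=
  [set x | exists m (p : 'I_m -> 'rV[R]_n) (c : 'I_m -> R),
    [/\ forall i, A (p i), forall i, 0 <= c i, \sum_i c i = 1
      & x = \sum_i c i *: p i]].

Definition aff {n} (A : set 'rV[R]_n) : set 'rV[R]_n :=
  [set x | exists m (p : 'I_m -> 'rV[R]_n) (c : 'I_m -> R),
    [/\ forall i, A (p i), \sum_i c i = 1 & x = \sum_i c i *: p i]].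

Definition dot {n} (u x : 'rV[R]_n) : R := \sum_i u 0 i * x 0 i.

Definition integral {n} : set 'rV[R]_n :=
  [set x | forall i, x 0 i \is a Num.int].

(* The (exposed) face of P with inner normal u; u = 0 gives P itself. *)
Definition face {n} (P : set 'rV[R]_n) (u : 'rV[R]_n) : set 'rV[R]_n :=
  [set x | P x /\ forall y, P y -> dot u x <= dot u y].

(* Facets are the inclusion-maximal proper faces, so that P need not be
   full-dimensional. *)
Definition facet {n} (P F : set 'rV[R]_n) : Prop :=
  [/\ exists u, F = face P u, F <> P
    & forall u, F `<=` face P u -> face P u = F \/ face P u = P].

(* For Q in R^n x R: the facets with an inner normal pointing upwards. *)
Definition lower_facet {n} (Q F : set 'rV[R]_(n + 1)) : Prop :=
  facet Q F /\ exists2 u : 'rV[R]_(n + 1), 0 < rsubmx u 0 0 & F = face Q u.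

(* Only the values of the height function w on the lattice points of P
   matter. *)
Definition lifted {n} (P : set 'rV[R]_n) (w : 'rV[R]_n -> R) :
    set 'rV[R]_(n + 1) :=
  conv [set row_mx p (const_mx (w p)) | p in P `&` integral].

Definition affinely_independent {n} (S : {fset 'rV[R]_n}) : Prop :=
  forall c : 'rV[R]_n -> R,
    \sum_(p <- S) c p = 0 -> \sum_(p <- S) c p *: p = 0 ->
    forall p, p \in S -> c p = 0.

(* A triangulation is given by the vertex sets of its maximal simplices. *)
Definition triangulation {n} (P : set 'rV[R]_n)
    (T : {fset {fset 'rV[R]_n}}) : Prop :=
  [/\ forall (S : {fset 'rV[R]_n}) p,
        S \in T -> p \in S -> (P `&` integral) p,
      forall S : {fset 'rV[R]_n}, S \in T -> affinely_independent S,
      forall S S' : {fset 'rV[R]_n},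
        S \in T -> S' \in T -> (S `<=` S')%fset -> S = S',
      P = \bigcup_(S in [set` T]) conv [set` S]
    & forall S S' : {fset 'rV[R]_n}, S \in T -> S' \in T ->
        conv [set` S] `&` conv [set` S'] = conv [set` (S `&` S')%fset]].

Definition regular {n} (P : set 'rV[R]_n) (T : {fset {fset 'rV[R]_n}}) :
    Prop :=
  exists w : 'rV[R]_n -> R, forall C : set 'rV[R]_n,
    (exists2 S : {fset 'rV[R]_n}, S \in T & C = conv [set` S]) <->
    (exists2 F, lower_facet (lifted P w) F & C = lsubmx @` F).

(* The rows of B form a Z-basis of the translation group of the affine
   lattice L. *)
Definition lattice_basis {n d} (L : set 'rV[R]_n) (B : 'M[R]_(d, n)) : Prop :=
  row_free B /\
  forall x, L x -> L = [set x + map_mx intr z *m B | z in [set: 'rV[int]_d]].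

(* v is the normalized volume of the simplex with vertex set S with respect
   to the affine lattice L: the absolute determinant of the edge vectors from
   one vertex in coordinates M with respect to a basis B of L (unimodular
   simplices have volume 1). *)
Definition normalized_volume {n} (L : set 'rV[R]_n) (S : {fset 'rV[R]_n})
    (v : R) : Prop :=
  exists d (B : 'M[R]_(d, n)) (p : 'I_d.+1 -> 'rV[R]_n) (M : 'M[R]_d),
    [/\ lattice_basis L B, [set` S] = range p,
        forall i, p (lift ord0 i) - p ord0 = row i (M *m B)
      & v = `|\det M|].

Definition unimodular {n} (P : set 'rV[R]_n) (T : {fset {fset 'rV[R]_n}}) :
    Prop :=
  forall S : {fset 'rV[R]_n}, S \in T -> normalized_volume (aff P `&` integral) S 1.

Definition dilated_simplex (k d : nat) : set 'rV[R]_d :=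
  conv (0 |` range (fun i : 'I_d => k%:R *: delta_mx 0 i)).

Definition cayley {d} (P Q : set 'rV[R]_d) : set 'rV[R]_(2 + d) :=
  conv ([set row_mx (delta_mx 0 ord0) x | x in P] `|`
        [set row_mx (delta_mx 0 ord_max) x | x in Q]).

End Polytopes.

Arguments dilated_simplex {R} k d _.

Section TropicalCurve.
Context {R : realType} {d : nat}.
Implicit Types (S F : {fset 'rV[R]_(2 + d)}).

Definition side (i : 'I_2) S : {fset 'rV[R]_(2 + d)} :=
  [fset p in S | lsubmx p == delta_mx 0 i]%fset.

Definition mixed S : bool := (2 <= #|` side ord0 S| <= 3)%N.

Definition simplex_facet F S : bool :=
  (F `<=` S)%fset && (#|` S| == #|` F|.+1).

(* A common facet of two distinct simplices is their intersection. *)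
Definition share_quadrilateral S S' : bool :=
  let F := (S `&` S')%fset in
  [&& simplex_facet F S, simplex_facet F S',
      #|` side ord0 F| == 2%N & #|` side ord_max F| == 2%N].

(* The adjacency relation of G(T), whose vertices are the mixed S in T. *)
Definition tropical_graph (T : {fset {fset 'rV[R]_(2 + d)}}) :
    rel {fset 'rV[R]_(2 + d)} :=
  fun S S' => [&& S \in T, S' \in T, mixed S, mixed S', S != S'
                & share_quadrilateral S S'].

End TropicalCurve.

Definition graph_cycle {V : eqType} (e : rel V) (c : seq V) : Prop :=
  (3 <= size c)%N /\ ucycle e c.

(* e has exactly one cycle, up to starting point and orientation, and it has
   n edges. *)
Definition unique_cycle_of_length {V : eqType} (e : rel V) (n : nat) : Prop :=
  exists c, [/\ graph_cycle e c, size c = n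
    & forall c', graph_cycle e c' ->
        exists k, c' = rot k c \/ c' = rot k (rev c)].

(* Main.v *)
(* Each triangulation is given by a height function together with its 32 cells.
   For every cell [S] the dual basis of its five vertices is integral, so the
   cell is unimodular, and the linear functional [u_S] that agrees with the
   heights on [S] lies strictly below them at the other lattice points, so [S]
   is the projection of a lower face. Two cells meet in a common face because
   [u_S - u_S'] is nonnegative on [S], nonpositive on [S'], and vanishes there
   only at common vertices. The cells cover the polytope because every facet of
   a cell is either on the boundary or shared with another cell: a point [x]
   lies in the cell that maximizes [u_S x], as crossing an interior facet towards
   [x] would increase [u_S x]. These finitely many integer conditions, and the
   shape of the dual graph, are checked by computation. *)

Require Import Defs.
From Stdlib Require Import ZArith.
From HB Require Import structures.
From mathcomp Require Import all_boot all_order all_algebra finmap.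
From mathcomp Require Import boolp classical_sets reals.
From mathcomp Require Import zify ssrZ lra.

Set Implicit Arguments.
Unset Strict Implicit.
Unset Printing Implicit Defensive.

Import Order.TTheory GRing.Theory Num.Theory.

Local Open Scope classical_set_scope.
Local Open Scope ring_scope.
(* The delimiter [%Z] would otherwise denote [int_scope]. *)
Local Delimit Scope Z_scope with Z.

(** * Linear functionals and convex hulls *)

(** The polytope lies in the hyperplane [x_1 + x_2 = 1], which avoids the origin. Affine functions
    on it are therefore linear functionals on R^5, the five vertices of a cell form a basis, and the
    dual basis yields barycentric coordinates. Covering, intersection and unimodularity all become
    statements about signs or integrality of dot products, and no volume is ever added up.
    Regularity has a converse half: the lifted polytope must have no lower facet besides those of
    the cells. This needs an argument about arbitrary upward normals, not only about the listed
    functionals. The cycle is unique for a combinatorial reason: it has no chords, and all other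
    cells can be stripped off as leaves or isolated vertices, so a second cycle has nowhere to go
    except along the first, in one of two directions. *)

Section Dot.
Context {R : realType} {n : nat}.
Implicit Types u x : 'rV[R]_n.

Lemma dotC u x : dot u x = dot x u.
Proof. by apply: eq_bigr => i _; rewrite mulrC. Qed.

Fact dot_is_linear u : linear (dot u : 'rV[R]_n -> R^o).
Proof.
move=> a x y; rewrite /dot scaler_sumr -big_split; apply: eq_bigr => i _ /=.
by rewrite !mxE mulrDr mulrCA.
Qed.

HB.instance Definition _ u :=
  GRing.isLinear.Build R 'rV[R]_n R^o _ (dot u) (dot_is_linear u).

Lemma dot_sumZ I (r : seq I) (c : I -> R) (p : I -> 'rV[R]_n) u :
  dot u (\sum_(i <- r) c i *: p i) = \sum_(i <- r) c i * dot u (p i).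
Proof. by rewrite linear_sum; apply: eq_bigr => i _; rewrite linearZ. Qed.

Lemma dotDl u v x : dot (u + v) x = dot u x + dot v x.
Proof. by rewrite dotC linearD/= !(dotC x). Qed.

Lemma dotZl a u x : dot (a *: u) x = a * dot u x.
Proof. by rewrite dotC linearZ/= (dotC x). Qed.

Lemma dotBl u v x : dot (u - v) x = dot u x - dot v x.
Proof. by rewrite dotC linearB/= !(dotC x). Qed.

Lemma dot_row_mx k u (v : 'rV[R]_k) x (y : 'rV[R]_k) :
  dot (row_mx u v) (row_mx x y) = dot u x + dot v y.
Proof.
rewrite /dot big_split_ord; congr (_ + _); apply: eq_bigr => i _.
  by rewrite !row_mxEl.
by rewrite !row_mxEr.
Qed.

End Dot.

Lemma dot_addn1 {R : realType} {n} (u y : 'rV[R]_(n + 1)) :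
  dot u y = dot (lsubmx u) (lsubmx y) + rsubmx u 0 0 * rsubmx y 0 0.
Proof. by rewrite -{1}[u]hsubmxK -{1}[y]hsubmxK dot_row_mx {2}/dot big_ord1. Qed.

Section Convexity.
Context {R : realType} {n : nat}.
Implicit Types (A B : set 'rV[R]_n) (u x : 'rV[R]_n).

Lemma sub_conv A : A `<=` conv A.
Proof.
move=> x Ax; exists 1%N, (fun=> x), (fun=> 1).
by split=> //; rewrite big_ord1 ?scale1r.
Qed.

Lemma conv_mono A B : A `<=` B -> conv A `<=` conv B.
Proof. by move=> sAB x [m [p [c [pA c0 c1 ->]]]]; exists m, p, c; split=> // i; apply/sAB/pA. Qed.

Lemma conv_ge A u a :
  (forall y, A y -> a <= dot u y) -> forall x, conv A x -> a <= dot u x.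
Proof.
move=> Aa x [m [p [c [pA c0 c1 ->]]]].
rewrite dot_sumZ -[a]mul1r -c1 mulr_suml.
by apply: ler_sum => i _; apply/ler_wpM2l/Aa/pA.
Qed.

Lemma conv_eq A u a :
  (forall y, A y -> dot u y = a) -> forall x, conv A x -> dot u x = a.
Proof.
move=> Aa x [m [p [c [pA c0 c1 ->]]]].
rewrite dot_sumZ -[a]mul1r -c1 mulr_suml.
by apply: eq_bigr => i _; rewrite Aa.
Qed.

(** A weighted mean of values that are at least [a] equals [a] only if every generator of nonzero
    weight attains [a]. *)
Lemma conv_tight A u a x : (forall y, A y -> a <= dot u y) ->
  conv A x -> dot u x = a -> conv (A `&` [set y | dot u y = a]) x.
Proof.
move=> Aa [m [p [c [pA c0 c1 xE]]]] xa.
have slack0 i : c i * (dot u (p i) - a) = 0.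
  have: \sum_i c i * (dot u (p i) - a) = 0.
    under eq_bigr do rewrite mulrBr.
    by rewrite sumrB -mulr_suml c1 mul1r -dot_sumZ -xE xa subrr.
  move/psumr_eq0P => /(_ _ i isT); apply=> j _.
  by rewrite mulr_ge0 ?c0// subr_ge0 Aa.
have tight i : c i != 0 -> dot u (p i) = a.
  move=> ci0; apply/eqP; rewrite -subr_eq0.
  by have /eqP := slack0 i; rewrite mulf_eq0 (negPf ci0).
have [i0 ci0] : exists i, c i != 0.
  apply/not_existsP => c_eq0; have /eqP := c1.
  rewrite big1 ?(eq_sym 0) ?oner_eq0// => i _.
  by apply/eqP/negbNE/negP/c_eq0.
(* [conv] constrains even the generators of weight 0, so these are replaced by the tight point
   [p i0]. *)
exists m, (fun i => if c i == 0 then p i0 else p i), c; split=> // [i|].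
  by case: eqP => [_|/eqP ci]; split; rewrite /= ?tight//; apply: pA.
by rewrite xE; apply: eq_bigr => i _; case: eqP => // ->; rewrite !scale0r.
Qed.

Lemma conv_seq (s : seq 'rV[R]_n) (A : set 'rV[R]_n) (c : 'rV[R]_n -> R) :
  {in s, forall p, A p} -> {in s, forall p, 0 <= c p} -> \sum_(p <- s) c p = 1 ->
  conv A (\sum_(p <- s) c p *: p).
Proof.
move=> sA c0 c1; exists (size s), (tnth (in_tuple s)), (c \o tnth (in_tuple s)).
split=> [i|i||]; first by apply: sA; apply: mem_tnth.
- by apply: c0; apply: mem_tnth.
- by rewrite -c1 [RHS]big_tnth.
- by rewrite big_tnth.
Qed.

Lemma aff_eq A u a :
  (forall y, A y -> dot u y = a) -> forall x, aff A x -> dot u x = a.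
Proof.
move=> Aa x [m [p [c [pA c1 ->]]]].
rewrite dot_sumZ -[a]mul1r -c1 mulr_suml.
by apply: eq_bigr => i _; rewrite Aa.
Qed.

Lemma aff_seq (s : seq 'rV[R]_n) (A : set 'rV[R]_n) (c : 'rV[R]_n -> R) :
  {in s, forall p, A p} -> \sum_(p <- s) c p = 1 -> aff A (\sum_(p <- s) c p *: p).
Proof.
move=> sA c1; exists (size s), (tnth (in_tuple s)), (c \o tnth (in_tuple s)).
split=> [i||]; first by apply: sA; apply: mem_tnth.
- by rewrite -c1 [RHS]big_tnth.
- by rewrite big_tnth.
Qed.

End Convexity.

Lemma conv_image {R : realType} {n m} (f : {linear 'rV[R]_n -> 'rV[R]_m})
  (A : set 'rV[R]_n) : f @` conv A = conv (f @` A).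
Proof.
apply/seteqP; split=> [_ [x [k [p [c [pA c0 c1 ->]]]] <-]|x [k [p [c [pA c0 c1 ->]]]]].
  exists k, (f \o p), c; split=> // [i|]; first by exists (p i).
  by rewrite linear_sum; apply: eq_bigr => i _; rewrite linearZ.
have /choice[q qP] : forall i, exists q, A q /\ f q = p i.
  by move=> i; have [q] := pA i; exists q.
exists (\sum_i c i *: q i); first by exists k, q, c; split=> // i; case: (qP i).
rewrite linear_sum; apply: eq_bigr => i _; rewrite linearZ.
by case: (qP i) => _ <-.
Qed.

(** * Local certificates for regular unimodular triangulations *)

Section Certificate.
Context {R : realType} {n : nat}.
Variables (P : set 'rV[R]_n) (V : {fset 'rV[R]_n}).
Variables (T : {fset {fset 'rV[R]_n}}) (w : 'rV[R]_n -> R) (h : 'rV[R]_n).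
Variables (u : {fset 'rV[R]_n} -> 'rV[R]_n).
Variables (l : {fset 'rV[R]_n} -> 'rV[R]_n -> 'rV[R]_n).
Implicit Types (S : {fset 'rV[R]_n}) (p q x : 'rV[R]_n).

Hypothesis latticeP : P `&` integral = [set` V].
Hypothesis convP : conv [set` V] `<=` P.
Hypothesis hP : forall x, P x -> dot h x = 1.
Hypothesis T_neq0 : T != fset0.
Hypothesis T_sub : forall S, S \in T -> {subset S <= V}.
Hypothesis T_miss : forall S, S \in T -> exists2 q, q \in V & q \notin S.
Hypothesis u_le : forall S p, S \in T -> p \in V -> dot (u S) p <= w p.
Hypothesis u_eq : forall S p,
  S \in T -> p \in V -> (dot (u S) p == w p) = (p \in S).
Hypothesis l_dual : forall S p q,
  S \in T -> p \in S -> q \in S -> dot (l S p) q = (p == q)%:R.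
Hypothesis l_span : forall S x,
  S \in T -> x = \sum_(p <- S) dot (l S p) x *: p.
Hypothesis l_int : forall S p x,
  S \in T -> p \in S -> integral x -> dot (l S p) x \is a Num.int.
Hypothesis T_facet : forall S p, S \in T -> p \in S ->
  (exists f, [/\ forall x, P x -> 0 <= dot f x, 0 < dot f p
                & {in S, forall q, q != p -> dot f q = 0}]) \/
  (exists2 S', S' \in T & S' != S /\ {in S, forall q, q != p -> q \in S'}).

(** * Covering and intersections of cells *)

Local Lemma V_P p : p \in V -> P p.
Proof. by move=> pV; have []: (P `&` integral) p by rewrite latticeP. Qed.

Local Lemma V_int p : p \in V -> integral p.
Proof. by move=> pV; have []: (P `&` integral) p by rewrite latticeP. Qed.

Local Lemma T_P S p : S \in T -> p \in S -> P p.
Proof. by move=> ST /(T_sub ST)/V_P. Qed.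

Local Lemma conv_P S : S \in T -> conv [set` S] `<=` P.
Proof. by move=> ST; apply: subset_trans convP; apply: conv_mono => p; apply: T_sub. Qed.

(** Every vertex has [h]-value 1, so the dual coordinates are barycentric on [P], and they sum to 0
    on differences of points of [P]. *)
Local Lemma l_sum S x : S \in T -> \sum_(p <- S) dot (l S p) x = dot h x.
Proof.
move=> ST; rewrite {2}(l_span x ST) dot_sumZ big_seq [RHS]big_seq.
by apply: eq_bigr => p pS; rewrite hP ?mulr1//; apply: T_P pS.
Qed.

Local Lemma dot_basis S f g : S \in T -> {in S, forall p, dot f p = dot g p} ->
  forall x, dot f x = dot g x.
Proof.
move=> ST fg x; rewrite (l_span x ST) !dot_sumZ big_seq [RHS]big_seq.
by apply: eq_bigr => p pS; rewrite fg.
Qed.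

(** Both sides agree on the basis [S]. The sign of a barycentric coordinate can thus be read off
    from any nonzero functional vanishing on the opposite facet: a boundary normal, or the
    difference of two cell functionals. *)
Local Lemma dot_facet S f p : S \in T -> p \in S ->
  {in S, forall q, q != p -> dot f q = 0} ->
  forall x, dot f x = dot f p * dot (l S p) x.
Proof.
move=> ST pS f0 x; rewrite {1}(l_span x ST) dot_sumZ (big_fsetD1 p)//=.
rewrite big_seq big1 ?addr0 1?mulrC// => q.
by rewrite in_fsetD1 => /andP[qp qS]; rewrite f0 ?mulr0.
Qed.

Local Lemma u_lt S p : S \in T -> p \in V -> p \notin S -> dot (u S) p < w p.
Proof. by move=> ST pV pS; rewrite lt_neqAle u_le// u_eq// pS. Qed.

(** A cell is recovered from its functional as the set of lattice points where the functional
    touches the heights. *)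
Local Lemma u_inj S S' :
  S \in T -> S' \in T -> {in V, forall p, dot (u S) p = dot (u S') p} -> S = S'.
Proof.
move=> ST ST' uu; apply/fsetP => p; apply/idP/idP => pS.
  by have pV := T_sub ST pS; rewrite -(u_eq ST') // -uu// u_eq.
by have pV := T_sub ST' pS; rewrite -(u_eq ST) // uu// u_eq.
Qed.

(* If [x] were beyond the facet opposite to [p], the neighbour across that
   facet would have a larger functional at [x]. *)
Local Lemma u_max_cover S x : S \in T -> P x ->
  (forall S', S' \in T -> dot (u S') x <= dot (u S) x) -> conv [set` S] x.
Proof.
move=> ST Px u_max; rewrite (l_span x ST).
apply: (@conv_seq _ _ _ _ (fun p => dot (l S p) x)) => [//|p pS|]; last first.
  by rewrite l_sum// hP.
have [[f [f0 fp fS]]|[S' ST' [SS' S'p]]] := T_facet ST pS.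
  by have := f0 _ Px; rewrite (dot_facet ST pS fS) pmulr_rge0.
have uS q : q \in S -> q != p -> dot (u S' - u S) q = 0.
  move=> qS qp; rewrite dotBl; apply/eqP; rewrite subr_eq0.
  have qV := T_sub ST qS.
  have /eqP -> : dot (u S') q == w q by rewrite u_eq// S'p.
  by rewrite eq_sym u_eq.
have pV := T_sub ST pS.
have /eqP uSp : dot (u S) p == w p by rewrite u_eq.
(* If [p] were in [S'], then [S] would be contained in [S'], the two functionals would agree on a
   basis, and [S'] would equal [S]. So [u S'] is strictly below the height at [p]. *)
have up : dot (u S' - u S) p < 0.
  rewrite dotBl uSp subr_lt0 u_lt//; apply/negP => pS'; move/negP: SS'; apply.
  apply/eqP/u_inj => // q _; apply/esym; move: q; apply: (dot_basis ST) => q qS.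
  have qV := T_sub ST qS.
  have /eqP -> : dot (u S) q == w q by rewrite u_eq.
  apply/esym/eqP; rewrite u_eq//.
  by case: (eqVneq q p) => [->//|]; apply: S'p.
have := u_max _ ST'; rewrite -subr_le0 -dotBl (dot_facet ST pS uS).
by rewrite nmulr_rle0.
Qed.

Local Lemma cover x : P x -> exists2 S, S \in T & conv [set` S] x.
Proof.
move=> Px; have /fset0Pn[S0 S0T] := T_neq0.
pose S := [arg max_(S > [` S0T]%fset) dot (u (val S)) x]%O.
exists (val S); first exact: valP.
apply: u_max_cover => //; first exact: valP.
move=> S' ST'; rewrite /S; case: Order.TotalTheory.arg_maxP => // S1 _ /(_ [` ST']%fset isT).
exact.
Qed.

Lemma certificate_triangulation : triangulation P T.
Proof.
split.
- by move=> S p ST pS; rewrite latticeP /=; apply: T_sub pS.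
- move=> S ST c _ c0 p pS.
  have := congr1 (dot (l S p)) c0; rewrite dot_sumZ linear0 (big_fsetD1 p)//=.
  rewrite l_dual// eqxx mulr1 big_seq big1 ?addr0// => q.
  rewrite in_fsetD1 => /andP[qp qS].
  by rewrite l_dual// eq_sym (negPf qp) mulr0.
- move=> S S' ST ST' /fsubsetP SS'; apply: u_inj => // p _.
  move: p; apply: (dot_basis ST) => p pS; have pV := T_sub ST pS.
  have /eqP -> : dot (u S) p == w p by rewrite u_eq.
  by apply/esym/eqP; rewrite u_eq// SS'.
- apply/seteqP; split=> [x /cover[S ST Sx]|x [S ST Sx]]; first by exists S.
  exact: conv_P Sx.
- move=> S S' ST ST'; apply/seteqP; split=> [x [Sx S'x]|x SS'x]; last first.
    by split; move: x SS'x; apply: conv_mono => p /=; rewrite in_fsetI => /andP[].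
  have dec S1 S2 : S1 \in T -> S2 \in T ->
      forall p, p \in S1 -> 0 <= dot (u S1 - u S2) p.
    move=> S1T S2T p pS1; rewrite dotBl subr_ge0; have pV := T_sub S1T pS1.
    by have /eqP -> : dot (u S1) p == w p; [rewrite u_eq | apply: u_le].
  have uu : dot (u S - u S') x = 0.
    apply/eqP; rewrite eq_le; apply/andP; split; last first.
      by apply: (conv_ge (A := [set` S])) => // p; apply: dec.
    rewrite -oppr_ge0 dotBl opprB -dotBl.
    by apply: (conv_ge (A := [set` S'])) => // p; apply: dec.
  have := conv_tight (dec S S' ST ST') Sx uu; apply: conv_mono => p [/= pS].
  rewrite dotBl => /eqP; rewrite subr_eq0 => /eqP pu.
  have pV := T_sub ST pS.
  by rewrite in_fsetI pS -(u_eq ST') // -pu u_eq.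
Qed.

(** * Lower faces of the lifted polytope *)

Local Lemma V_neq0 : exists p, p \in V.
Proof. by have /fset0Pn[S /T_miss[p pV _]] := T_neq0; exists p. Qed.

Local Lemma S_neq0 S : S \in T -> exists p, p \in S.
Proof.
move=> ST; apply/fset0Pn/eqP => S0; have [p pV] := V_neq0.
have := hP (V_P pV); rewrite (l_span p ST) S0 big_seq_fset0 linear0 => /eqP.
by rewrite eq_sym oner_eq0.
Qed.

Local Notation liftw p := (row_mx p (const_mx (w p)) : 'rV[R]_(n + 1)).
Local Notation Q := (lifted P w).

(** The upward normal of the hyperplane through the lifted cell; at a lifted lattice point it
    measures the gap between the height and [u S]. *)
Local Definition up S : 'rV[R]_(n + 1) := row_mx (- u S) (const_mx 1).

Local Lemma dot_lift v p :
  dot v (liftw p) = dot (lsubmx v) p + rsubmx v 0 0 * w p.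
Proof. by rewrite dot_addn1 row_mxKl row_mxKr [const_mx _ 0 0]mxE. Qed.

Local Lemma dot_up S p : dot (up S) (liftw p) = w p - dot (u S) p.
Proof. by rewrite dot_lift row_mxKl row_mxKr mxE mul1r dotC linearN/= dotC addrC. Qed.

Local Lemma lift_Q p : p \in V -> Q (liftw p).
Proof. by move=> pV; apply: sub_conv; exists p => //; rewrite latticeP. Qed.

Local Lemma conv_lift_Q S : S \in T ->
  conv [set liftw p | p in [set` S]] `<=` Q.
Proof.
move=> ST; apply: conv_mono => _ [p pS <-]; exists p => //.
by rewrite latticeP; apply: T_sub pS.
Qed.

Local Lemma up_ge0 S y : S \in T -> Q y -> 0 <= dot (up S) y.
Proof.
move=> ST; apply: conv_ge => _ [p Pp <-]; rewrite dot_up subr_ge0 u_le//.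
by rewrite latticeP in Pp.
Qed.

Local Lemma up_lift_ge0 S p : S \in T -> p \in V -> 0 <= dot (up S) (liftw p).
Proof. by move=> ST pV; apply: up_ge0 => //; apply: lift_Q. Qed.

Local Lemma up_eq0 S y : S \in T ->
  conv [set liftw p | p in [set` S]] y -> dot (up S) y = 0.
Proof.
move=> ST; apply: conv_eq => _ [p pS <-]; rewrite dot_up; apply/eqP.
by rewrite subr_eq0 eq_sym u_eq//; apply: T_sub pS.
Qed.

Local Lemma face_up S : S \in T ->
  face Q (up S) = conv [set liftw p | p in [set` S]].
Proof.
move=> ST; apply/seteqP; split=> [y [Qy ymin]|y Sy]; last first.
  split=> [|z Qz]; first exact: conv_lift_Q Sy.
  by rewrite up_eq0// up_ge0.
have y0 : dot (up S) y = 0.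
  have [p pS] := S_neq0 ST; apply/eqP; rewrite eq_le up_ge0// andbT.
  rewrite -(@up_eq0 S (liftw p)) ?ymin//; first exact/lift_Q/(T_sub ST).
  by apply: sub_conv; exists p.
apply: conv_mono (conv_tight _ Qy y0) => [_ [[p Pp <-]]|z Lz]; last first.
  by apply: up_ge0 => //; apply: sub_conv.
rewrite latticeP in Pp; rewrite /= dot_up => /eqP.
by rewrite subr_eq0 eq_sym u_eq// => pS; exists p.
Qed.

Local Lemma lsub_lift S :
  lsubmx @` conv [set liftw p | p in [set` S]] = conv [set` S].
Proof.
rewrite conv_image image_comp; congr conv.
by apply/seteqP; split=> [_ [p pS <-]|p pS]; [|exists p]; rewrite //= row_mxKl.
Qed.

(** A normal [v] whose face contains the lifted cell is, up to a constant, a multiple [t] of the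
    cell normal. A lattice point outside [S] shows that [t] is nonnegative; then [t > 0] gives the
    cell face and [t = 0] the whole polytope. *)
Local Lemma facet_up S : S \in T -> facet Q (face Q (up S)).
Proof.
move=> ST; have [q qV qS] := T_miss ST.
have q0 : 0 < dot (up S) (liftw q) by rewrite dot_up subr_gt0 u_lt.
split; first by exists (up S).
  move=> FQ; have := lift_Q qV; rewrite -FQ face_up// => /(up_eq0 ST) qE.
  by rewrite qE ltxx in q0.
move=> v Fv; have [p0 p0S] := S_neq0 ST.
set m := dot v (liftw p0); set t := rsubmx v 0 0.
have Fin p : p \in S -> face Q v (liftw p).
  by move=> pS; apply: Fv; rewrite face_up//; apply: sub_conv; exists p.
have vS p : p \in S -> dot v (liftw p) = m.
  move=> pS; have [Qp pm] := Fin p pS; have [Qp0 p0m] := Fin p0 p0S.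
  by apply/eqP; rewrite eq_le pm// p0m.
(* The functionals [lsubmx v + t *: u S] and [m *: h] agree on the basis [S], hence everywhere. *)
have vE p : p \in V -> dot (v - t *: up S) (liftw p) = m.
  move=> pV; rewrite dotBl dotZl dot_up dot_lift -/t.
  have := dot_basis (f := lsubmx v + t *: u S) (g := m *: h) ST.
  move=> /(_ _ p); rewrite dotDl !dotZl hP ?mulr1; last exact: V_P.
  move=> <-; first by rewrite mulrBr opprB addrA addrAC addrK.
  move=> r rS.
  have rV := T_sub ST rS; rewrite dotDl !dotZl hP ?mulr1; last exact: V_P.
  have /eqP -> : dot (u S) r == w r by rewrite u_eq.
  by rewrite -(vS r rS) dot_lift.
have vQ y : Q y -> dot v y = m + t * dot (up S) y.
  move=> Qy; apply/eqP; rewrite -subr_eq; apply/eqP.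
  rewrite -dotZl -dotBl.
  by apply: conv_eq Qy => _ [p Pp <-]; rewrite latticeP in Pp; apply: vE.
have t0 : 0 <= t.
  have [_ /(_ _ (lift_Q qV))] := Fin p0 p0S.
  by rewrite -/m (vQ _ (lift_Q qV)) lerDl pmulr_lge0.
move: t0; rewrite le_eqVlt => /orP[/eqP t0|t0]; [right|left].
  apply/seteqP; split=> [y []//|y Qy]; split=> // z Qz.
  by rewrite !vQ// -t0 !mul0r.
apply/seteqP; split=> y [Qy ymin]; split=> // z Qz; have := ymin z Qz.
  by rewrite !vQ// lerD2l ler_pM2l.
by rewrite !vQ// lerD2l ler_pM2l.
Qed.

(* The minimizers over [V] lie in a single cell: the cell that contains their
   barycentre. *)
Local Lemma face_in_cell v : 0 < rsubmx v 0 0 ->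
  exists2 S, S \in T & face Q v `<=` face Q (up S).
Proof.
move=> t0; have [p0 p0V] := V_neq0.
have [p1 p1V p1min] : exists2 p, p \in V &
    {in V, forall q, dot v (liftw p) <= dot v (liftw q)}.
  pose p := [arg min_(p < [` p0V]%fset) dot v (liftw (val p))]%O.
  exists (val p); first exact: valP.
  move=> q qV; rewrite /p; case: Order.TotalTheory.arg_minP => // p' _.
  by move=> /(_ [` qV]%fset isT).
set m := dot v (liftw p1) in p1min.
have Qm y : Q y -> m <= dot v y.
  apply: conv_ge => _ [p Pp <-]; rewrite latticeP in Pp; exact: p1min.
pose A := [fset p in V | dot v (liftw p) == m]%fset.
have p1A : p1 \in A by rewrite !inE p1V eqxx.
have AV p : p \in A -> p \in V by rewrite !inE => /andP[].
have Am p : p \in A -> dot v (liftw p) = m by rewrite !inE => /andP[_ /eqP].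
pose k : R := (size A)%:R.
have k0 : 0 < k by rewrite ltr0n cardfs_gt0; apply/fset0Pn; exists p1.
have sum_k : \sum_(p <- A) k^-1 = 1.
  by rewrite big_const_seq count_predT iter_addr_0 -mulr_natl divff// gt_eqF.
pose y0 := \sum_(p <- A) k^-1 *: liftw p.
have y0m : dot v y0 = m.
  rewrite dot_sumZ -[m]mul1r -sum_k mulr_suml big_seq [RHS]big_seq.
  by apply: eq_bigr => p /Am ->.
have Py0 : P (lsubmx y0).
  rewrite linear_sum; under eq_bigr do rewrite linearZ/= row_mxKl.
  apply: convP; apply: (@conv_seq _ _ _ _ (fun=> k^-1)) => // p _.
  by rewrite invr_ge0 ltW.
have [S ST] := cover Py0; rewrite -lsub_lift => -[y Sy yE].
have A_S p : p \in A -> p \in S.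
  (* [y] lies on the lifted cell directly above or below [y0]. As [y0] minimizes the upward normal
     [v], it is not higher than [y], so its gap is at most 0. Gaps of lifted lattice points are
     nonnegative, so every minimizer in the average has gap 0. *)
  have : dot (up S) y0 <= 0.
    have vB z : dot z y - dot z y0 = rsubmx z 0 0 * (rsubmx y 0 0 - rsubmx y0 0 0).
      by rewrite !dot_addn1 yE opprD addrACA subrr add0r -mulrBr.
    have : 0 <= dot v y - dot v y0.
      by rewrite y0m subr_ge0 Qm//; apply: conv_lift_Q Sy.
    rewrite vB pmulr_rge0// => y_ge0.
    by rewrite -(up_eq0 ST Sy) -subr_ge0 vB row_mxKr mxE mul1r.
  rewrite dot_sumZ -mulr_sumr pmulr_rle0 ?invr_gt0// => s_le0 pA.
  have pV := AV p pA; rewrite -(u_eq ST)// eq_sym -subr_eq0 -dot_up.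
  rewrite eq_le up_lift_ge0// andbT; apply: le_trans s_le0.
  rewrite (big_fsetD1 p)//= lerDl big_seq; apply: sumr_ge0 => q.
  by rewrite in_fsetD1 => /andP[_ qA]; rewrite up_lift_ge0 ?AV.
exists S => // z [Qz zmin]; rewrite face_up//.
have zm : dot v z = m by apply/eqP; rewrite eq_le Qm// zmin//; apply: lift_Q.
apply: conv_mono (conv_tight _ Qz zm) => [_ [[p Pp <-]] /= /eqP pm|z' Lz']; last first.
  by apply: Qm; apply: sub_conv.
rewrite latticeP in Pp; exists p => //; apply: A_S; rewrite !inE pm andbT.
exact: Pp.
Qed.

Lemma certificate_regular : regular P T.
Proof.
exists w => C; split=> [[S ST ->]|[F [[_ FQ Fmax] [v v0 FE]] ->]].
  exists (face Q (up S)); last by rewrite face_up// lsub_lift.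
  split; first exact: facet_up.
  by exists (up S); rewrite ?row_mxKr ?mxE.
(* By maximality of [F], the cell face containing it is [F] itself or the whole polytope; the latter
   is excluded because cell faces are proper. *)
have [S ST] := face_in_cell v0; rewrite -FE => FS.
exists S; first exact: ST.
rewrite -lsub_lift -face_up//; have [->//|SQ] := Fmax _ FS.
by have [_ []] := facet_up ST.
Qed.

(** * Lattice bases from cells *)

Local Lemma aff_cell S x : S \in T -> aff P x <-> dot h x = 1.
Proof.
move=> ST; split=> [|hx]; first exact: aff_eq hP _.
rewrite (l_span x ST); apply: (@aff_seq _ _ _ _ (fun p => dot (l S p) x)).
  by move=> p /(T_P ST).
by rewrite l_sum.
Qed.

Lemma certificate_unimodular : unimodular P T.
Proof.
move=> S ST; pose d := #|` S|.-1.
have sizeS : size S = d.+1.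
  by rewrite prednK// cardfs_gt0; apply/fset0Pn/S_neq0.
pose p (i : 'I_d.+1) : 'rV[R]_n := nth 0 S i.
have pS i : p i \in S by rewrite mem_nth// sizeS.
have p_eq i j : (p i == p j) = (i == j).
  by rewrite nth_uniq ?sizeS ?fset_uniq.
pose B := \matrix_(i < d) (p (lift ord0 i) - p ord0).
have sum_p (V' : nmodType) (F : 'rV[R]_n -> V') :
    \sum_(q <- S) F q = F (p ord0) + \sum_(i < d) F (p (lift ord0 i)).
  by rewrite (big_nth 0) sizeS big_mkord big_ord_recl.
have p_int i : integral (p i) by apply/V_int/(T_sub ST).
(* The edge vectors at [p ord0] serve as the lattice basis, so the coordinate matrix is the
   identity; the content is that they generate the lattice. *)
exists d, B, p, 1%:M; split.
- split.
    (* The right inverse of [B] collects the dual functionals of the other vertices, all of which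
       vanish at [p ord0]. *)
    apply/row_freeP; exists (\matrix_(j, i) l S (p (lift ord0 i)) 0 j).
    apply/matrixP => i k; rewrite !mxE.
    transitivity (dot (l S (p (lift ord0 k))) (p (lift ord0 i) - p ord0)).
      by apply: eq_bigr => j _; rewrite !mxE mulrC.
    rewrite linearB/= !l_dual// !p_eq (inj_eq lift_inj) [_ == ord0]eq_sym.
    by rewrite (negPf (neq_lift _ _)) subr0 eq_sym.
  move=> x [/(aff_cell x ST) hx xint]; apply/seteqP; split.
    move=> y [/(aff_cell y ST) hy yint].
    have Dint : integral (y - x).
      by move=> i; rewrite !mxE rpredB ?xint ?yint.
    exists (\row_i Num.floor (dot (l S (p (lift ord0 i))) (y - x))) => //.
    apply/eqP; rewrite eq_sym addrC -subr_eq eq_sym; apply/eqP.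
    (* As [h] vanishes on [y - x], the coordinate at [p ord0] is minus the sum of the others, which
       turns the expansion in vertices into one in edges with integer coefficients. *)
    have := l_sum (y - x) ST; rewrite linearB/= hx hy subrr sum_p.
    move=> /eqP; rewrite addr_eq0 => /eqP l0.
    rewrite [RHS](l_span _ ST) sum_p l0 scaleNr scaler_suml mulmx_sum_row.
    rewrite addrC -sumrB; apply: eq_bigr => i _.
    by rewrite rowK !mxE floorK ?l_int// scalerBr.
  move=> _ [z _ <-]; split.
    apply/(aff_cell _ ST); rewrite linearD/= hx mulmx_sum_row dot_sumZ.
    rewrite big1 ?addr0// => i _.
    by rewrite rowK linearB/= !hP ?subrr ?mulr0//; apply: (T_P ST).
  move=> j; rewrite !mxE rpredD ?xint// rpred_sum// => i _.
  by rewrite !mxE rpredM ?rpredB ?intr_int//; apply: p_int.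
- apply/seteqP; split=> [q /= qS|_ [i _ <-]]; last exact: pS.
  have qi : (index q S < d.+1)%N by rewrite -sizeS index_mem.
  by exists (Ordinal qi) => //; rewrite /p nth_index.
- by move=> i; rewrite mul1mx rowK.
- by rewrite det1 normr1.
Qed.

End Certificate.

(** * Graphs with a unique cycle *)

Section UniqueCycle.
Context {V : eqType}.
Implicit Types (e : rel V) (c t : seq V) (x y : V).

Lemma uniq_traject_next x c :
  uniq (x :: c) -> x :: c = traject (next (x :: c)) x (size c).+1.
Proof.
move=> /cycle_next; set f := next _; rewrite /cycle rcons_path.
by move=> /andP[/fpathP[k ->] _]; rewrite size_traject.
Qed.

Lemma iter_next c x y :
  uniq c -> x \in c -> y \in c -> exists k, y = iter k (next c) x.
Proof.
move=> uc xc; have [i p cE] := rot_to xc.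
rewrite -(mem_rot i) cE uniq_traject_next -?cE ?rot_uniq//.
move=> /trajectP[k _ ->]; exists k.
by apply: eq_iter => z; rewrite next_rot.
Qed.

(** Otherwise [x] and its predecessor would be closed under [next], and the orbit of [x], which is
    all of [c], would have at most two elements. *)
Lemma next_neq_prev c x :
  uniq c -> (2 < size c)%N -> x \in c -> next c x != prev c x.
Proof.
move=> uc sc xc; apply/eqP => np; move: sc; rewrite ltnNge => /negP; apply.
apply: (@uniq_leq_size _ _ [:: x; prev c x]) => // y /(iter_next uc xc)[k ->].
elim: k => [|k]; first by rewrite mem_head.
rewrite !inE iterS => /orP[]/eqP ->; rewrite ?next_prev//.
  by rewrite np eqxx orbT.
by rewrite eqxx.
Qed.

Lemma next_neq c x : uniq c -> (2 < size c)%N -> x \in c -> next c x != x.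
Proof.
move=> uc sc xc; apply: contraTneq (next_neq_prev uc sc xc) => nx.
by rewrite negbK -{2}nx prev_next// nx.
Qed.

(** [c'] is closed under the successor map of [c], which is transitive on [c], so both lists
    traverse the same orbit. *)
Lemma rot_of_next c c' : uniq c -> uniq c' -> c' != [::] -> {subset c' <= c} ->
  {in c', next c' =1 next c} -> exists k, c' = rot k c.
Proof.
case: c' => // x p uc uc' _ sc nc.
have [i q cE] := rot_to (sc _ (mem_head x p)).
have nE y : y \in x :: p -> next (x :: p) y = next (x :: q) y.
  by move=> yp; rewrite nc// -cE next_rot.
have uq : uniq (x :: q) by rewrite -cE rot_uniq.
have iterE k : iter k (next (x :: p)) x = iter k (next (x :: q)) x.
  have ip j : iter j (next (x :: p)) x \in x :: p.
    by elim: j => [|j IH]; rewrite ?mem_head// iterS mem_next.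
  by elim: k => // k IH; rewrite !iterS -IH nE.
have sub_pq : {subset x :: q <= x :: p}.
  move=> y /(iter_next uq (mem_head x q))[k ->]; rewrite -iterE.
  by elim: k => [|k IH]; rewrite ?mem_head// iterS mem_next.
have sz : size p = size q.
  apply/eqP; rewrite -eqSS eqn_leq; apply/andP; split.
    by apply: (@uniq_leq_size _ (x :: p) (x :: q)) => // y /sc; rewrite -(mem_rot i) cE.
  exact: (@uniq_leq_size _ (x :: q) (x :: p)).
exists i; rewrite cE (uniq_traject_next uc') (uniq_traject_next uq) sz.
apply: (@eq_from_nth _ x) => [|j]; rewrite size_traject ?size_traject// => jq.
by rewrite !nth_traject.
Qed.

(** The direction chosen at [x] persists: a step along [next c] followed by one along [prev c] would
    return to the vertex just left, making successor and predecessor in [c'] coincide. *)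
Lemma rot_of_adjacent c c' x : uniq c -> uniq c' -> (2 < size c')%N ->
  {subset c' <= c} -> x \in c' ->
  {in c', forall y, next c' y = next c y \/ next c' y = prev c y} ->
  next c' x = next c x -> exists k, c' = rot k c.
Proof.
move=> uc uc' sc' sub xc' nc nx; apply: rot_of_next => //.
  by case: c' sc' {sub xc' nc nx uc'}.
move=> y /(iter_next uc' xc')[k ->].
have ic j : iter j (next c') x \in c'.
  by elim: j => [|j IH] //; rewrite iterS mem_next.
elim: k => // k IH; rewrite iterS; set z := iter k _ x in IH *.
have zc : next c' z \in c' by rewrite mem_next ic.
have [//|nz] := nc _ zc.
have := next_neq_prev uc' sc' (ic k.+1).
by rewrite iterS -/z nz prev_next// IH prev_next// eqxx.
Qed.

(* Removing the vertices of [t] in reverse order, each one is a leaf or isolated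
   when it is removed. *)
Fixpoint pruning e c t : bool :=
  if t is x :: t' then (count (e x) c <= 1)%N && pruning e (rcons c x) t'
  else true.

(** A vertex on a cycle has two distinct neighbours there, its successor and its predecessor. The
    induction discards the tail of [t] first, so that both neighbours of the head [x] would have to
    lie in [c]. *)
Lemma pruning_cycle e c t c' : symmetric e -> pruning e c t ->
  graph_cycle e c' -> {subset c' <= c ++ t} -> {subset c' <= c}.
Proof.
move=> esym + [sc' /andP[cyc uc']].
elim: t c => [|x t IH] c /=; first by rewrite cats0.
move=> /andP[cx pt]; rewrite -cat_rcons => /IH - /(_ pt) sub y yc'.
have := sub y yc'; rewrite mem_rcons inE => /orP[/eqP yx|//]; exfalso.
rewrite {y}yx in yc'.
have nx : next c' x \in [seq z <- c | e x z].
  rewrite mem_filter (next_cycle cyc)//=.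
  have := sub (next c' x); rewrite mem_next mem_rcons inE => /(_ yc').
  by rewrite (negPf (next_neq uc' sc' yc')).
have px : prev c' x \in [seq z <- c | e x z].
  rewrite mem_filter esym (prev_cycle cyc)//=.
  have := sub (prev c' x); rewrite mem_prev mem_rcons inE => /(_ yc') /orP[/eqP px|//].
  have := next_neq uc' sc' yc'.
  by rewrite -{1}px next_prev// eqxx.
have : (size [:: next c' x; prev c' x] <= size [seq z <- c | e x z])%N.
  apply: uniq_leq_size => [|z]; first by rewrite /= inE next_neq_prev.
  by rewrite !inE => /orP[]/eqP ->.
by rewrite size_filter leqNgt ltnS cx.
Qed.

(** Any cycle survives the pruning, hence stays in [c]; there the degree bound leaves [next c] and
    [prev c] as the only neighbours of a vertex. *)
Lemma unique_cycle e c t : symmetric e -> (forall x y, e x y -> x \in c ++ t) ->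
  graph_cycle e c -> {in c, forall x, (count (e x) c <= 2)%N} -> pruning e c t ->
  unique_cycle_of_length e (size c).
Proof.
move=> esym ect gc c2 pr; exists c; split=> // c' gc'.
have [sc /andP[cyc uc]] := gc; have [sc' /andP[cyc' uc']] := gc'.
have sub : {subset c' <= c}.
  apply: (pruning_cycle esym pr gc') => x xc'.
  by apply: ect (next_cycle cyc' xc').
have nc : {in c', forall x, next c' x = next c x \/ next c' x = prev c x}.
  move=> x xc'; have xc := sub x xc'.
  case: (eqVneq (next c' x) (next c x)) => [->|nn]; first by left.
  case: (eqVneq (next c' x) (prev c x)) => [->|np]; first by right.
  have : (size [:: next c' x; next c x; prev c x] <= size [seq z <- c | e x z])%N.
    apply: uniq_leq_size => [|z].
      by rewrite /= !inE negb_or nn np next_neq_prev.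
    rewrite !inE mem_filter => /or3P[]/eqP ->.
    - by rewrite (next_cycle cyc')// sub// mem_next.
    - by rewrite (next_cycle cyc)// mem_next.
    - by rewrite esym (prev_cycle cyc)// mem_prev.
  by rewrite size_filter leqNgt ltnS c2.
have [x xc'] : exists x, x \in c'.
  by case: c' sc' {gc' cyc' uc' sub nc} => // x c' _; exists x; rewrite mem_head.
case: (nc x xc') => nx.
  by have [k ->] := rot_of_adjacent uc uc' sc' sub xc' nc nx; exists k; left.
(* Reversing [c] exchanges [next] and [prev], which reduces the backward direction to the forward
   one. *)
have [||||k ->] := @rot_of_adjacent (rev c) c' x _ uc' sc' _ xc'.
- by rewrite rev_uniq.
- by move=> y; rewrite mem_rev; apply: sub.
- by move=> y yc'; rewrite next_rev// prev_rev//; case: (nc y yc'); [right|left].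
- by rewrite next_rev.
by exists k; right.
Qed.

End UniqueCycle.

(** * The Cayley polytope *)

Section Polytope.
Context {R : realType}.

Lemma dilated_simplexP k d (x : 'rV[R]_d) : (0 < k)%N ->
  dilated_simplex k d x <-> (forall j, 0 <= x 0 j) /\ \sum_j x 0 j <= k%:R.
Proof.
move=> k0; have kR : k%:R != 0 :> R by rewrite pnatr_eq0 -lt0n.
have dot_delta j (y : 'rV[R]_d) : dot (delta_mx 0 j) y = y 0 j.
  rewrite /dot (bigD1 j)//= mxE !eqxx mul1r big1 ?addr0// => i /negPf ij.
  by rewrite mxE eqxx ij mul0r.
have dot_one (y : 'rV[R]_d) : dot (const_mx (-1)) y = - \sum_j y 0 j.
  by rewrite -sumrN; apply: eq_bigr => j _; rewrite mxE mulN1r.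
split=> [Dx|[x0 xk]].
  split=> [j|].
    rewrite -dot_delta; apply: conv_ge Dx => y [->|[i _ <-]].
      by rewrite linear0.
    by rewrite dot_delta !mxE eqxx mulr_ge0// ler0n.
  rewrite -lerN2 -dot_one; apply: conv_ge Dx => y [->|[i _ <-]].
    by rewrite linear0 oppr_le0 ler0n.
  rewrite dot_one lerN2 (bigD1 i)//= !mxE !eqxx mulr1 big1 ?addr0// => j /negPf ij.
  by rewrite !mxE ij andbF mulr0.
(* Index [ord0] stands for the origin, which absorbs the weight left over by the vertices
   [k%:R *: delta_mx 0 j]. *)
exists d.+1, (fun i => if unlift ord0 i is Some j then k%:R *: delta_mx 0 j else 0).
exists (fun i => if unlift ord0 i is Some j then x 0 j / k%:R
                 else 1 - (\sum_j x 0 j) / k%:R).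
split.
- by move=> i; case: unliftP => [j _|_]; [right; exists j|left].
- move=> i; case: unliftP => [j _|_]; first by rewrite divr_ge0.
  by rewrite subr_ge0 ler_pdivrMr ?mul1r// ltr0n.
- rewrite big_ord_recl unlift_none; under [X in _ + X]eq_bigr do rewrite liftK.
  by rewrite -mulr_suml subrK.
- rewrite big_ord_recl unlift_none scaler0 add0r; under eq_bigr do rewrite liftK.
  rewrite {1}[x]row_sum_delta; apply: eq_bigr => j _.
  by rewrite scalerA divfK.
Qed.

Lemma cayley_dilatedP k d (y : 'rV[R]_(2 + d)) : (0 < k)%N ->
  cayley (dilated_simplex k d) (dilated_simplex k d) y <->
  [/\ forall i, 0 <= lsubmx y 0 i, \sum_i lsubmx y 0 i = 1
    & dilated_simplex k d (rsubmx y)].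
Proof.
move=> k0; pose A := dilated_simplex (R := R) k d.
split=> [[m [p [c [pA c0 c1 ->]]]]|[y0 y1 Dy]].
  have /choice[q qP] : forall i, exists q : 'I_2 * 'rV[R]_d,
      A q.2 /\ p i = row_mx (delta_mx 0 q.1) q.2.
    by move=> i; case: (pA i) => -[x Ax <-]; [exists (ord0, x)|exists (ord_max, x)].
  have lE : lsubmx (\sum_i c i *: p i) = \sum_i c i *: delta_mx 0 (q i).1.
    rewrite linear_sum; apply: eq_bigr => i _; rewrite linearZ/=.
    by case: (qP i) => _ ->; rewrite row_mxKl.
  have rE : rsubmx (\sum_i c i *: p i) = \sum_i c i *: (q i).2.
    rewrite linear_sum; apply: eq_bigr => i _; rewrite linearZ/=.
    by case: (qP i) => _ ->; rewrite row_mxKr.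
  rewrite lE rE; split.
  - move=> i; rewrite summxE; apply: sumr_ge0 => j _.
    by rewrite !mxE mulr_ge0// ler0n.
  - under eq_bigr do rewrite summxE; rewrite exchange_big/= -c1.
    apply: eq_bigr => j _; rewrite (bigD1 (q j).1)//= !mxE !eqxx mulr1.
    by rewrite big1 ?addr0// => i /negPf ij; rewrite !mxE ij andbF mulr0.
  have qA i : A (q i).2 by case: (qP i).
  apply/dilated_simplexP => //; split=> [j|].
    rewrite summxE; apply: sumr_ge0 => i _; rewrite !mxE mulr_ge0//.
    by have /(dilated_simplexP _ k0)[] := qA i.
  under eq_bigr do rewrite summxE; rewrite exchange_big/= -[leRHS]mul1r -[X in X * _]c1 mulr_suml.
  apply: ler_sum => i _; under eq_bigr do rewrite mxE; rewrite -mulr_sumr.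
  apply: ler_wpM2l => //. by have /(dilated_simplexP _ k0)[] := qA i.
(* Both copies carry the same simplex, so [rsubmx y] can be used in each, weighted by the two
   entries of [lsubmx y]. *)
exists 2%N, (fun i => row_mx (delta_mx 0 i) (rsubmx y)), (lsubmx y 0); split=> //.
  move=> i; case: (unliftP ord_max i) => [j ->|->]; [left|right]; exists (rsubmx y) => //.
  by congr row_mx; congr delta_mx; apply: val_inj; case: j => -[|//] /=.
rewrite -{1}[y]hsubmxK; under eq_bigr do rewrite scale_row_mx.
apply/rowP => j; rewrite summxE; case: (split_ordP j) => i ->.
  rewrite row_mxEl (bigD1 i)//= row_mxEl [X in X + _]mxE [X in _ * X + _]mxE !eqxx mulr1.
  rewrite big1 ?addr0// => l /negPf li.
  by rewrite row_mxEl mxE [X in _ * X]mxE [i == l]eq_sym li andbF mulr0.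
rewrite row_mxEr; under eq_bigr do rewrite row_mxEr mxE.
by rewrite -mulr_suml y1 mul1r.
Qed.

End Polytope.

(** * Integer certificates *)

Section IntegerVectors.
Local Open Scope Z_scope.

Definition zdot (s t : seq Z) : Z :=
  foldr (fun xy => Z.add (Z.mul xy.1 xy.2)) 0 (zip s t).

(** Laplace expansion along the first column; zero entries are skipped to save the evaluation of
    their minors. *)
Fixpoint zdet (n : nat) (M : seq (seq Z)) : Z :=
  if n is n'.+1 then
    foldr (fun i a =>
      match head 0 (nth [::] M i) with
      | Z0 => a
      | x => (if odd i then - x else x)
             * zdet n' (map behead (take i M ++ drop i.+1 M)) + a
      end) 0 (iota 0 n)
  else 1.

Definition zunit (i : nat) : seq Z := set_nth 0 (nseq 5 0) i 1.

(* Cramer's rule; only meaningful when the determinant is 1 or -1. *)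
Definition zdual (M : seq (seq Z)) : seq (seq Z) :=
  let d := zdet 5 M in
  [seq [seq d * zdet 5 (set_nth [::] M k (zunit j)) | j <- iota 0 5]
      | k <- iota 0 5].

Definition zcomb (c : seq Z) (M : seq (seq Z)) : seq Z :=
  [seq zdot c [seq nth 0 v j | v <- M] | j <- iota 0 5].

(* The ten lattice points of each copy of the dilated simplex: indices below 10
   belong to the copy over [e_1], the others to the copy over [e_2]. *)
Definition nodes : seq (seq Z) :=
  let S := [:: [:: 0; 0; 0]; [:: 0; 0; 1]; [:: 0; 0; 2]; [:: 0; 1; 0]; [:: 0; 1; 1];
               [:: 0; 2; 0]; [:: 1; 0; 0]; [:: 1; 0; 1]; [:: 1; 1; 0]; [:: 2; 0; 0]] in
  [seq [:: 1, 0 & v] | v <- S] ++ [seq [:: 0, 1 & v] | v <- S].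

(** Inner facet normals; the last one is the inequality of coordinate sum at most 2, made
    homogeneous by [x_1 + x_2 = 1]. *)
Definition zfacets : seq (seq Z) :=
  [:: [:: 1; 0; 0; 0; 0]; [:: 0; 1; 0; 0; 0]; [:: 0; 0; 1; 0; 0];
      [:: 0; 0; 0; 1; 0]; [:: 0; 0; 0; 0; 1]; [:: 2; 2; -1; -1; -1]].

Definition node (i : nat) : seq Z := nth [::] nodes i.
Definition height (w : seq nat) (i : nat) : Z := Z.of_nat (nth 0%N w i).

Definition dual_basis (S : seq nat) : seq (seq Z) := zdual (map node S).

Definition functional (w S : seq nat) : seq Z :=
  zcomb (map (height w) S) (dual_basis S).

(** Strictly increasing lists make the index list of a vertex set canonical. *)
Definition well_formed (S : seq nat) : bool :=
  [&& size S == 5%N, sorted ltn S & all (gtn 20%N) S].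

(** The output of Cramer's rule is tested rather than proved correct: an integral matrix passing
    this test is the dual basis. *)
Definition dual_ok (S : seq nat) : bool :=
  let D := dual_basis S in
  all (fun k => all (fun j =>
    zdot (nth [::] D k) (node (nth 0%N S j)) == if k == j then 1 else 0)
    (iota 0 5)) (iota 0 5).

Definition lower_ok (w S : seq nat) : bool :=
  let u := functional w S in
  all (fun i => if i \in S then zdot u (node i) == height w i
                else zdot u (node i) <? height w i) (iota 0 20).

(** For a neighbour it suffices to contain [F]; that it lies on the other side of [F] follows from
    [lower_ok] for both cells. *)
Definition facets_ok (T : seq (seq nat)) (S : seq nat) : bool :=
  all (fun i =>
    let F := [seq j <- S | j != i] in
    has (fun f => all (fun j => zdot f (node j) == 0) F && (0 <? zdot f (node i)))
        zfacets
    || has (fun S' => (S' != S) && all (mem S') F) T) S.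

Definition cell_ok w T S : bool :=
  [&& well_formed S, dual_ok S, lower_ok w S & facets_ok T S].

End IntegerVectors.

Section IndexGraph.
Local Open Scope nat_scope.

Definition index_mixed (S : seq nat) : bool := 2 <= count (gtn 10) S <= 3.

Definition index_adjacent (S S' : seq nat) : bool :=
  let F := [seq i <- S | i \in S'] in
  [&& index_mixed S, index_mixed S', S != S', size F == 4 & count (gtn 10) F == 2].

(** The cells after the cycle must be ordered so that each has at most one neighbour among the
    earlier ones; cells that are not mixed are isolated. *)
Definition graph_ok (n : nat) (T : seq (seq nat)) : bool :=
  let c := take n T in
  [&& uniq T, size c == n, cycle index_adjacent c,
      all (fun S => count (index_adjacent S) c <= 2) c
    & pruning index_adjacent c (drop n T)].

Definition certificate_ok n (C : seq nat * seq (seq nat)) : bool :=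
  all (cell_ok C.1 C.2) C.2 && graph_ok n C.2.

(* Heights and cells for cycle length [n = 3, ..., 16]; the first [n] cells form
   the cycle, in cyclic order. *)
Definition certificates : seq (seq nat * seq (seq nat)) :=
  [:: ([:: 10; 5; 5; 4; 1; 5; 0; 5; 4; 10; 5; 2; 1; 0; 0; 2; 0; 2; 0; 5],
    [::
     [:: 4; 6; 12; 13; 14]; [:: 4; 6; 12; 14; 18]; [:: 4; 6; 13; 14; 18]; [:: 4; 6; 11; 12; 13];
     [:: 4; 6; 12; 17; 18]; [:: 4; 6; 13; 15; 18]; [:: 1; 4; 6; 11; 12]; [:: 1; 4; 6; 11; 13];
     [:: 4; 6; 7; 12; 17]; [:: 4; 6; 7; 17; 18]; [:: 4; 5; 6; 13; 15]; [:: 4; 5; 6; 15; 18];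
     [:: 1; 6; 10; 11; 13]; [:: 6; 7; 17; 18; 19]; [:: 1; 3; 6; 10; 13]; [:: 6; 7; 8; 18; 19];
     [:: 0; 1; 3; 6; 10]; [:: 1; 2; 4; 6; 12]; [:: 1; 3; 4; 6; 13]; [:: 2; 4; 6; 7; 12];
     [:: 3; 4; 5; 6; 13]; [:: 4; 5; 6; 8; 18]; [:: 4; 6; 7; 8; 18]; [:: 4; 13; 14; 15; 18];
     [:: 6; 7; 8; 9; 19]; [:: 6; 10; 11; 13; 16]; [:: 6; 11; 12; 13; 16]; [:: 6; 12; 13; 14; 16];
     [:: 6; 12; 14; 16; 18]; [:: 6; 12; 16; 17; 18]; [:: 6; 13; 14; 16; 18]; [:: 6; 16; 17; 18; 19]]);
   ([:: 5; 0; 2; 1; 2; 5; 2; 0; 4; 4; 5; 2; 5; 2; 0; 4; 0; 1; 0; 3],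
    [::
     [:: 1; 3; 7; 14; 18]; [:: 1; 3; 14; 16; 18]; [:: 1; 3; 7; 16; 18]; [:: 1; 7; 14; 16; 18];
     [:: 3; 4; 7; 14; 18]; [:: 1; 3; 13; 14; 16]; [:: 3; 6; 7; 16; 18]; [:: 1; 7; 14; 16; 17];
     [:: 3; 4; 5; 14; 18]; [:: 1; 3; 10; 13; 16]; [:: 6; 7; 9; 16; 18]; [:: 1; 2; 7; 14; 17];
     [:: 3; 5; 14; 15; 18]; [:: 0; 1; 3; 10; 16]; [:: 7; 9; 16; 18; 19]; [:: 1; 2; 11; 14; 17];
     [:: 0; 1; 3; 6; 16]; [:: 1; 2; 4; 7; 14]; [:: 1; 3; 4; 7; 14]; [:: 1; 3; 6; 7; 16];
     [:: 1; 10; 11; 13; 16]; [:: 1; 11; 13; 14; 16]; [:: 1; 11; 14; 16; 17]; [:: 2; 11; 12; 14; 17];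
     [:: 3; 4; 5; 7; 18]; [:: 3; 5; 7; 8; 18]; [:: 3; 6; 7; 9; 18]; [:: 3; 7; 8; 9; 18];
     [:: 3; 13; 14; 15; 18]; [:: 3; 13; 14; 16; 18]; [:: 7; 14; 16; 17; 18]; [:: 7; 16; 17; 18; 19]]);
   ([:: 4; 0; 1; 2; 1; 4; 3; 0; 4; 6; 6; 4; 4; 3; 0; 4; 0; 2; 0; 4],
    [::
     [:: 1; 3; 4; 14; 18]; [:: 1; 3; 14; 16; 18]; [:: 1; 3; 7; 16; 18]; [:: 1; 7; 14; 16; 18];
     [:: 1; 4; 7; 14; 18]; [:: 3; 4; 5; 14; 18]; [:: 1; 3; 13; 14; 16]; [:: 3; 6; 7; 16; 18];
     [:: 1; 2; 7; 14; 16]; [:: 3; 5; 14; 15; 18]; [:: 0; 1; 3; 13; 16]; [:: 6; 7; 9; 16; 18];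
     [:: 1; 2; 12; 14; 16]; [:: 2; 7; 14; 16; 17]; [:: 0; 1; 10; 13; 16]; [:: 7; 9; 16; 18; 19];
     [:: 0; 1; 3; 6; 16]; [:: 1; 2; 4; 7; 14]; [:: 1; 3; 4; 7; 18]; [:: 1; 3; 6; 7; 16];
     [:: 1; 10; 11; 14; 16]; [:: 1; 10; 13; 14; 16]; [:: 1; 11; 12; 14; 16]; [:: 2; 12; 14; 16; 17];
     [:: 3; 4; 5; 7; 18]; [:: 3; 5; 7; 8; 18]; [:: 3; 6; 7; 8; 18]; [:: 3; 13; 14; 15; 18];
     [:: 3; 13; 14; 16; 18]; [:: 6; 7; 8; 9; 18]; [:: 7; 14; 16; 17; 18]; [:: 7; 16; 17; 18; 19]]);
   ([:: 5; 0; 1; 3; 0; 5; 3; 0; 2; 4; 7; 4; 4; 4; 0; 7; 0; 2; 1; 2],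
    [::
     [:: 1; 3; 4; 14; 16]; [:: 1; 4; 7; 14; 16]; [:: 4; 7; 14; 16; 18]; [:: 4; 7; 8; 16; 18];
     [:: 3; 4; 8; 16; 18]; [:: 3; 4; 14; 16; 18]; [:: 1; 3; 13; 14; 16]; [:: 1; 2; 7; 14; 16];
     [:: 7; 8; 16; 18; 19]; [:: 3; 4; 5; 14; 18]; [:: 0; 1; 3; 13; 16]; [:: 1; 2; 12; 14; 16];
     [:: 2; 7; 14; 16; 17]; [:: 7; 8; 9; 16; 19]; [:: 3; 5; 13; 14; 18]; [:: 0; 1; 10; 13; 16];
     [:: 0; 1; 3; 6; 16]; [:: 1; 2; 4; 7; 14]; [:: 1; 3; 4; 8; 16]; [:: 1; 3; 6; 8; 16];
     [:: 1; 4; 7; 8; 16]; [:: 1; 6; 7; 8; 16]; [:: 1; 10; 11; 14; 16]; [:: 1; 10; 13; 14; 16];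
     [:: 1; 11; 12; 14; 16]; [:: 2; 12; 14; 16; 17]; [:: 3; 4; 5; 8; 18]; [:: 3; 13; 14; 16; 18];
     [:: 5; 13; 14; 15; 18]; [:: 6; 7; 8; 9; 16]; [:: 7; 14; 16; 17; 19]; [:: 7; 14; 16; 18; 19]]);
   ([:: 4; 2; 6; 0; 0; 1; 4; 4; 1; 7; 7; 4; 5; 1; 0; 3; 0; 2; 0; 4],
    [::
     [:: 1; 3; 4; 14; 16]; [:: 1; 4; 14; 16; 17]; [:: 1; 4; 7; 16; 17]; [:: 4; 7; 8; 16; 17];
     [:: 4; 8; 16; 17; 18]; [:: 3; 4; 8; 16; 18]; [:: 3; 4; 14; 16; 18]; [:: 1; 3; 13; 14; 16];
     [:: 1; 4; 12; 14; 17]; [:: 7; 8; 16; 17; 19]; [:: 3; 4; 5; 14; 18]; [:: 0; 1; 3; 13; 16];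
     [:: 1; 2; 4; 12; 17]; [:: 7; 8; 9; 16; 19]; [:: 3; 5; 13; 14; 18]; [:: 0; 1; 11; 13; 16];
     [:: 0; 1; 3; 6; 16]; [:: 0; 10; 11; 13; 16]; [:: 1; 2; 4; 7; 17]; [:: 1; 3; 4; 8; 16];
     [:: 1; 3; 6; 8; 16]; [:: 1; 4; 7; 8; 16]; [:: 1; 6; 7; 8; 16]; [:: 1; 11; 12; 14; 16];
     [:: 1; 11; 13; 14; 16]; [:: 1; 12; 14; 16; 17]; [:: 3; 4; 5; 8; 18]; [:: 3; 13; 14; 16; 18];
     [:: 4; 14; 16; 17; 18]; [:: 5; 13; 14; 15; 18]; [:: 6; 7; 8; 9; 16]; [:: 8; 16; 17; 18; 19]]);
   ([:: 2; 0; 2; 0; 0; 3; 2; 1; 2; 5; 3; 0; 5; 2; 1; 6; 0; 3; 2; 6],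
    [::
     [:: 1; 3; 4; 11; 16]; [:: 1; 4; 7; 11; 16]; [:: 4; 7; 11; 14; 16]; [:: 4; 7; 14; 16; 18];
     [:: 4; 7; 8; 16; 18]; [:: 3; 4; 8; 16; 18]; [:: 3; 4; 14; 16; 18]; [:: 3; 4; 11; 14; 16];
     [:: 0; 1; 3; 11; 16]; [:: 2; 4; 7; 11; 14]; [:: 7; 8; 9; 16; 18]; [:: 3; 4; 5; 14; 18];
     [:: 0; 3; 10; 11; 16]; [:: 2; 7; 11; 14; 17]; [:: 7; 9; 16; 18; 19]; [:: 3; 5; 13; 14; 18];
     [:: 0; 1; 3; 6; 16]; [:: 1; 2; 4; 7; 11]; [:: 1; 3; 4; 7; 16]; [:: 1; 3; 6; 7; 16];
     [:: 2; 11; 12; 14; 17]; [:: 3; 4; 5; 8; 18]; [:: 3; 4; 7; 8; 16]; [:: 3; 6; 7; 8; 16];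
     [:: 3; 10; 11; 13; 16]; [:: 3; 11; 13; 14; 16]; [:: 3; 13; 14; 16; 18]; [:: 5; 13; 14; 15; 18];
     [:: 6; 7; 8; 9; 16]; [:: 7; 11; 14; 16; 17]; [:: 7; 14; 16; 17; 18]; [:: 7; 16; 17; 18; 19]]);
   ([:: 0; 0; 5; 4; 7; 10; 0; 3; 3; 4; 6; 3; 10; 3; 1; 2; 0; 6; 0; 6],
    [::
     [:: 0; 1; 6; 15; 18]; [:: 0; 1; 14; 15; 18]; [:: 0; 1; 14; 16; 18]; [:: 0; 1; 6; 16; 18];
     [:: 1; 6; 7; 16; 18]; [:: 1; 7; 14; 16; 18]; [:: 1; 7; 8; 14; 18]; [:: 1; 8; 14; 15; 18];
     [:: 1; 6; 8; 15; 18]; [:: 0; 1; 11; 14; 16]; [:: 6; 7; 9; 16; 18]; [:: 1; 2; 7; 14; 16];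
     [:: 1; 2; 8; 14; 15]; [:: 7; 9; 16; 18; 19]; [:: 1; 2; 11; 14; 16]; [:: 2; 7; 14; 16; 17];
     [:: 0; 1; 3; 8; 15]; [:: 0; 1; 6; 8; 15]; [:: 0; 10; 11; 13; 16]; [:: 0; 11; 13; 14; 16];
     [:: 0; 13; 14; 15; 16]; [:: 0; 14; 15; 16; 18]; [:: 1; 2; 4; 8; 15]; [:: 1; 2; 7; 8; 14];
     [:: 1; 3; 5; 8; 15]; [:: 1; 4; 5; 8; 15]; [:: 1; 6; 7; 8; 18]; [:: 2; 11; 12; 14; 17];
     [:: 2; 11; 14; 16; 17]; [:: 6; 7; 8; 9; 18]; [:: 7; 14; 16; 17; 18]; [:: 7; 16; 17; 18; 19]]);
   ([:: 0; 0; 7; 2; 5; 6; 1; 5; 4; 7; 5; 3; 6; 1; 0; 0; 2; 3; 0; 6],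
    [::
     [:: 0; 1; 6; 15; 18]; [:: 0; 1; 14; 15; 18]; [:: 0; 1; 14; 16; 18]; [:: 0; 1; 6; 16; 18];
     [:: 1; 6; 16; 17; 18]; [:: 1; 6; 7; 17; 18]; [:: 1; 7; 14; 17; 18]; [:: 1; 7; 8; 14; 18];
     [:: 1; 8; 14; 15; 18]; [:: 1; 6; 8; 15; 18]; [:: 0; 1; 11; 14; 16]; [:: 6; 7; 9; 17; 18];
     [:: 1; 2; 7; 14; 17]; [:: 1; 4; 8; 14; 15]; [:: 6; 9; 17; 18; 19]; [:: 1; 2; 12; 14; 17];
     [:: 0; 1; 3; 6; 15]; [:: 0; 10; 11; 13; 16]; [:: 0; 11; 13; 14; 16]; [:: 0; 13; 14; 15; 18];
     [:: 0; 13; 14; 16; 18]; [:: 1; 2; 4; 7; 14]; [:: 1; 3; 5; 8; 15]; [:: 1; 3; 6; 8; 15];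
     [:: 1; 4; 5; 8; 15]; [:: 1; 4; 7; 8; 14]; [:: 1; 6; 7; 8; 18]; [:: 1; 11; 12; 14; 17];
     [:: 1; 11; 14; 16; 17]; [:: 1; 14; 16; 17; 18]; [:: 6; 7; 8; 9; 18]; [:: 6; 16; 17; 18; 19]]);
   ([:: 3; 0; 3; 1; 0; 3; 3; 2; 2; 6; 7; 3; 5; 1; 0; 0; 4; 3; 0; 5],
    [::
     [:: 0; 1; 3; 13; 18]; [:: 0; 1; 13; 16; 18]; [:: 0; 1; 6; 16; 18]; [:: 1; 6; 16; 18; 19];
     [:: 1; 6; 7; 18; 19]; [:: 1; 7; 17; 18; 19]; [:: 1; 7; 14; 17; 18]; [:: 1; 4; 7; 14; 18];
     [:: 1; 4; 14; 15; 18]; [:: 1; 3; 4; 15; 18]; [:: 1; 3; 13; 15; 18]; [:: 0; 1; 11; 13; 16];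
     [:: 6; 7; 9; 18; 19]; [:: 1; 2; 7; 14; 17]; [:: 3; 4; 8; 15; 18]; [:: 1; 2; 12; 14; 17];
     [:: 0; 1; 3; 6; 18]; [:: 0; 10; 11; 13; 16]; [:: 1; 2; 4; 7; 14]; [:: 1; 3; 4; 8; 18];
     [:: 1; 3; 6; 8; 18]; [:: 1; 4; 7; 8; 18]; [:: 1; 6; 7; 8; 18]; [:: 1; 11; 12; 14; 17];
     [:: 1; 11; 13; 14; 18]; [:: 1; 11; 13; 16; 18]; [:: 1; 11; 14; 17; 18]; [:: 1; 11; 16; 17; 18];
     [:: 1; 13; 14; 15; 18]; [:: 1; 16; 17; 18; 19]; [:: 3; 4; 5; 8; 15]; [:: 6; 7; 8; 9; 18]]);
   ([:: 4; 0; 0; 3; 1; 6; 3; 1; 3; 6; 6; 1; 2; 2; 0; 2; 2; 0; 0; 2],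
    [::
     [:: 0; 1; 3; 13; 18]; [:: 0; 1; 13; 16; 18]; [:: 0; 1; 6; 16; 18]; [:: 1; 6; 16; 18; 19];
     [:: 1; 6; 7; 18; 19]; [:: 1; 7; 17; 18; 19]; [:: 1; 2; 7; 17; 18]; [:: 1; 2; 14; 17; 18];
     [:: 1; 2; 4; 14; 18]; [:: 1; 4; 14; 15; 18]; [:: 1; 3; 4; 15; 18]; [:: 1; 3; 13; 15; 18];
     [:: 0; 1; 11; 13; 16]; [:: 6; 7; 8; 18; 19]; [:: 1; 2; 11; 14; 17]; [:: 3; 4; 8; 15; 18];
     [:: 0; 1; 3; 6; 18]; [:: 0; 10; 11; 13; 16]; [:: 1; 2; 4; 7; 18]; [:: 1; 3; 4; 8; 18];
     [:: 1; 3; 6; 8; 18]; [:: 1; 4; 7; 8; 18]; [:: 1; 6; 7; 8; 18]; [:: 1; 11; 13; 14; 18];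
     [:: 1; 11; 13; 16; 18]; [:: 1; 11; 14; 17; 18]; [:: 1; 11; 16; 17; 18]; [:: 1; 13; 14; 15; 18];
     [:: 1; 16; 17; 18; 19]; [:: 2; 11; 12; 14; 17]; [:: 3; 4; 5; 8; 15]; [:: 6; 7; 8; 9; 19]]);
   ([:: 6; 0; 0; 4; 0; 5; 6; 1; 3; 8; 8; 3; 5; 3; 1; 0; 4; 3; 0; 7],
    [::
     [:: 0; 1; 3; 15; 18]; [:: 0; 1; 13; 15; 18]; [:: 0; 1; 13; 16; 18]; [:: 0; 1; 6; 16; 18];
     [:: 1; 6; 7; 16; 18]; [:: 1; 7; 16; 17; 18]; [:: 1; 2; 7; 17; 18]; [:: 1; 2; 11; 17; 18];
     [:: 1; 2; 11; 14; 18]; [:: 1; 2; 14; 15; 18]; [:: 1; 2; 4; 15; 18]; [:: 1; 4; 8; 15; 18];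
     [:: 1; 3; 8; 15; 18]; [:: 0; 1; 10; 13; 16]; [:: 6; 7; 9; 16; 18]; [:: 7; 9; 16; 18; 19];
     [:: 0; 1; 3; 8; 18]; [:: 0; 1; 6; 8; 18]; [:: 1; 2; 4; 7; 18]; [:: 1; 3; 4; 8; 15];
     [:: 1; 4; 7; 8; 18]; [:: 1; 6; 7; 8; 18]; [:: 1; 10; 11; 13; 16]; [:: 1; 11; 13; 15; 18];
     [:: 1; 11; 13; 16; 18]; [:: 1; 11; 14; 15; 18]; [:: 1; 11; 16; 17; 18]; [:: 2; 11; 12; 14; 17];
     [:: 2; 11; 14; 17; 18]; [:: 3; 4; 5; 8; 15]; [:: 6; 7; 8; 9; 18]; [:: 7; 16; 17; 18; 19]]);
   ([:: 9; 0; 3; 8; 4; 9; 1; 0; 3; 0; 9; 2; 7; 7; 7; 9; 4; 1; 0; 0],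
    [::
     [:: 1; 2; 4; 11; 18]; [:: 1; 2; 11; 17; 18]; [:: 1; 2; 7; 17; 18]; [:: 1; 7; 17; 18; 19];
     [:: 1; 7; 9; 18; 19]; [:: 1; 6; 9; 18; 19]; [:: 1; 6; 11; 18; 19]; [:: 1; 6; 10; 11; 18];
     [:: 1; 6; 10; 13; 18]; [:: 1; 3; 6; 13; 18]; [:: 1; 3; 5; 13; 18]; [:: 1; 5; 13; 15; 18];
     [:: 1; 4; 5; 15; 18]; [:: 1; 4; 11; 15; 18]; [:: 2; 4; 11; 14; 18]; [:: 0; 1; 6; 10; 13];
     [:: 0; 1; 3; 6; 13]; [:: 1; 2; 4; 7; 18]; [:: 1; 3; 5; 6; 18]; [:: 1; 4; 5; 8; 18];
     [:: 1; 4; 7; 8; 18]; [:: 1; 5; 6; 8; 18]; [:: 1; 6; 8; 9; 18]; [:: 1; 7; 8; 9; 18];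
     [:: 1; 10; 11; 13; 18]; [:: 1; 11; 13; 15; 18]; [:: 1; 11; 17; 18; 19]; [:: 2; 11; 12; 14; 18];
     [:: 2; 11; 12; 17; 18]; [:: 4; 11; 14; 15; 18]; [:: 6; 10; 11; 16; 18]; [:: 6; 11; 16; 18; 19]]);
   ([:: 5; 0; 3; 6; 5; 8; 2; 0; 1; 0; 9; 5; 9; 6; 5; 9; 4; 2; 0; 0],
    [::
     [:: 0; 1; 3; 13; 18]; [:: 0; 1; 10; 13; 18]; [:: 0; 1; 10; 16; 18]; [:: 0; 1; 16; 18; 19];
     [:: 0; 1; 6; 18; 19]; [:: 1; 6; 9; 18; 19]; [:: 1; 7; 9; 18; 19]; [:: 1; 7; 17; 18; 19];
     [:: 1; 2; 7; 17; 18]; [:: 1; 2; 14; 17; 18]; [:: 1; 2; 4; 14; 18]; [:: 1; 4; 5; 14; 18];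
     [:: 1; 5; 14; 15; 18]; [:: 1; 5; 13; 15; 18]; [:: 1; 3; 5; 13; 18]; [:: 1; 2; 11; 14; 17];
     [:: 0; 1; 3; 8; 18]; [:: 0; 1; 6; 8; 18]; [:: 1; 2; 4; 8; 18]; [:: 1; 2; 7; 8; 18];
     [:: 1; 3; 5; 8; 18]; [:: 1; 4; 5; 8; 18]; [:: 1; 6; 8; 9; 18]; [:: 1; 7; 8; 9; 18];
     [:: 1; 10; 11; 13; 18]; [:: 1; 10; 11; 16; 18]; [:: 1; 11; 13; 14; 18]; [:: 1; 11; 14; 17; 18];
     [:: 1; 11; 16; 18; 19]; [:: 1; 11; 17; 18; 19]; [:: 1; 13; 14; 15; 18]; [:: 2; 11; 12; 14; 17]]);
   ([:: 0; 0; 8; 1; 5; 5; 4; 8; 4; 9; 0; 2; 8; 2; 6; 5; 0; 4; 0; 1],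
    [::
     [:: 0; 1; 3; 10; 18]; [:: 0; 1; 10; 16; 18]; [:: 0; 1; 16; 18; 19]; [:: 0; 1; 3; 18; 19];
     [:: 1; 3; 8; 18; 19]; [:: 1; 4; 8; 18; 19]; [:: 1; 2; 4; 18; 19]; [:: 1; 2; 17; 18; 19];
     [:: 1; 2; 12; 17; 18]; [:: 1; 2; 4; 12; 18]; [:: 1; 4; 12; 14; 18]; [:: 1; 4; 14; 15; 18];
     [:: 1; 4; 5; 15; 18]; [:: 1; 3; 5; 15; 18]; [:: 1; 3; 13; 15; 18]; [:: 1; 3; 10; 13; 18];
     [:: 0; 1; 3; 8; 19]; [:: 0; 1; 6; 8; 19]; [:: 1; 2; 4; 8; 19]; [:: 1; 2; 7; 8; 19];
     [:: 1; 3; 5; 8; 18]; [:: 1; 4; 5; 8; 18]; [:: 1; 6; 8; 9; 19]; [:: 1; 7; 8; 9; 19];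
     [:: 1; 10; 11; 13; 18]; [:: 1; 10; 11; 16; 18]; [:: 1; 11; 12; 14; 18]; [:: 1; 11; 12; 17; 18];
     [:: 1; 11; 13; 15; 18]; [:: 1; 11; 14; 15; 18]; [:: 1; 11; 16; 18; 19]; [:: 1; 11; 17; 18; 19]])].

End IndexGraph.

(** The first certificate has cycle length 3, hence the shift by 3; [iota 3 14] runs from 3 to
    16. *)
Lemma certificates_ok :
  all (fun n => certificate_ok n (nth ([::], [::]) certificates (n - 3))) (iota 3 14).
Proof. by vm_compute. Qed.

(** * From integer certificates to the polytope *)

Section Realization.
Context {R : realType}.
Implicit Types (s t : seq Z) (S : seq nat).

(** The certificates use the binary integers [Z], which evaluate fast; this map carries the results
    to the real field. *)
Definition ZR (z : Z) : R := (int_of_Z z)%:~R.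

Lemma ZR0 : ZR 0%Z = 0. Proof. by []. Qed.
Lemma ZR1 : ZR 1%Z = 1. Proof. by []. Qed.
Lemma ZRD x y : ZR (x + y)%Z = ZR x + ZR y.
Proof. by rewrite /ZR (rmorphD int_of_Z) intrD. Qed.
Lemma ZRM x y : ZR (x * y)%Z = ZR x * ZR y.
Proof. by rewrite /ZR (rmorphM int_of_Z) intrM. Qed.
Lemma ZRN x : ZR (- x)%Z = - ZR x.
Proof. by rewrite /ZR (rmorphN int_of_Z) intrN. Qed.
Lemma ZR_int x : ZR x \is a Num.int. Proof. exact: intr_int. Qed.

Lemma ZR_inj : injective ZR.
Proof. by move=> x y /intr_inj /(can_inj int_of_ZK). Qed.

Lemma ZR_ge0 x : (0 <= ZR x) = (0 <=? x)%Z.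
Proof. by rewrite ler0z; case: x => //= p; rewrite le0z_nat. Qed.

Lemma ZR_gt0 x : (0 < ZR x) = (0 <? x)%Z.
Proof.
rewrite lt_neqAle ZR_ge0 -ZR0 (inj_eq ZR_inj).
by case: x.
Qed.

Lemma ZR_lt x y : (ZR x < ZR y) = (x <? y)%Z.
Proof. by rewrite -subr_gt0 -ZRN -ZRD ZR_gt0; lia. Qed.

Definition zvec {n} s : 'rV[R]_n := \row_i ZR (nth 0%Z s i).

Lemma zvec_int n s : integral (zvec s : 'rV_n).
Proof. by move=> i; rewrite mxE ZR_int. Qed.

Lemma zvec_inj n s t :
  size s = n -> size t = n -> zvec s = zvec t :> 'rV_n -> s = t.
Proof.
move=> sn tn st; apply: (@eq_from_nth _ 0%Z) => [|i]; first by rewrite tn.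
rewrite sn => i_n; apply: ZR_inj.
by have := congr1 (fun v : 'rV_n => v 0 (Ordinal i_n)) st; rewrite !mxE.
Qed.

Lemma dot_zvec n s t : size s = n -> dot (zvec s : 'rV_n) (zvec t) = ZR (zdot s t).
Proof.
move=> sn; transitivity (\sum_(i < n) ZR (nth 0%Z s i) * ZR (nth 0%Z t i)).
  by apply: eq_bigr => i _; rewrite !mxE.
elim: n s t sn => [|n IH] [|x s] [|y t] //= sn; rewrite ?big_ord0//.
  by rewrite big1 // => i _; rewrite [X in _ * X](_ : _ = 0) ?mulr0 ?nth_nil.
by case: sn => sn; rewrite big_ord_recl/= ZRD ZRM -(IH _ _ sn).
Qed.

(** * Inequalities and lattice points of the polytope *)

Local Notation P :=
  (cayley (dilated_simplex 2 3) (dilated_simplex 2 3) : set 'rV[R]_(2 + 3)).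
Local Notation vec := (zvec : seq Z -> 'rV[R]_(2 + 3)).

(** The functional [x_1 + x_2], which takes the role of [h]. *)
Definition zlevel : seq Z := [:: 1; 1; 0; 0; 0]%Z.

Lemma dot_vec5 a b c d e (y : 'rV[R]_(2 + 3)) :
  dot (vec [:: a; b; c; d; e]) y =
  ZR a * lsubmx y 0 0 + (ZR b * lsubmx y 0 1 + (ZR c * rsubmx y 0 0
    + (ZR d * rsubmx y 0 1 + ZR e * rsubmx y 0 2%:R))).
Proof.
rewrite /dot !big_ord_recl big_ord0 addr0 !mxE /=.
by do 4?[congr (_ + _)]; congr (_ * y 0 _); apply: val_inj.
Qed.

Lemma cayleyP (y : 'rV[R]_(2 + 3)) :
  P y <-> dot (vec zlevel) y = 1 /\
          {in zfacets, forall f, 0 <= dot (vec f) y}.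
Proof.
have sum2 (F : 'I_2 -> R) : \sum_i F i = F 0 + F 1.
  by rewrite !big_ord_recl big_ord0 addr0; congr (_ + F _); apply: val_inj.
have sum3 (F : 'I_3 -> R) : \sum_i F i = F 0 + F 1 + F 2%:R.
  rewrite !big_ord_recl big_ord0 addr0 addrA.
  by congr (_ + F _ + F _); apply: val_inj.
have ZR2 : ZR 2 = 2 by [].
have ZRN1 : ZR (-1) = -1 by [].
pose simp := (dot_vec5, ZR0, ZR1, ZR2, ZRN1, mul0r, mul1r, addr0, add0r).
rewrite (cayley_dilatedP y (ltn0Sn 1)).
split=> [[y0 + /(dilated_simplexP _ (ltn0Sn 1))[x0]]|[]]; rewrite ?sum2 ?sum3.
  move=> y1 x2; split; first by rewrite !simp.
  move=> f; rewrite !inE => /or4P[/eqP->|/eqP->|/eqP->|/or3P[]/eqP->];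
    rewrite !simp//; lra.
rewrite !simp => y1 yf.
have [y00 y01] : 0 <= lsubmx y 0 0 /\ 0 <= lsubmx y 0 1.
  by split; [have := yf (nth [::] zfacets 0) isT|have := yf (nth [::] zfacets 1) isT];
    rewrite !simp.
have x00 := yf (nth [::] zfacets 2) isT.
have x01 := yf (nth [::] zfacets 3) isT.
have x02 := yf (nth [::] zfacets 4) isT.
have x2 := yf (nth [::] zfacets 5) isT.
rewrite !simp in x00 x01 x02 x2; split=> //.
  move=> i; case: (unliftP 0 i) => [j ->|->//].
  by rewrite (ord1 j) (_ : lift _ _ = 1)//; apply: val_inj.
apply/(dilated_simplexP _ (ltn0Sn 1)); rewrite sum3; split; last lra.
by case=> -[|[|[|//]]] i3; [move: x00|move: x01|move: x02];
  congr (0 <= rsubmx y 0 _); apply: val_inj.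
Qed.
Lemma node_P i : (i < 20)%N -> P (vec (node i)).
Proof.
move=> i20; have: all (fun i => (zdot zlevel (node i) == 1%Z) &&
    all (fun f => (size f == 5%N) && (0 <=? zdot f (node i))%Z) zfacets) (iota 0 20).
  by vm_compute.
move=> /allP/(_ i); rewrite mem_iota => /(_ i20)/andP[/eqP p1 /allP pf].
apply/cayleyP; rewrite dot_zvec// p1; split=> // f /pf/andP[/eqP f5 f0].
by rewrite dot_zvec// ZR_ge0.
Qed.

Lemma lattice_node (y : 'rV[R]_(2 + 3)) :
  P y -> integral y -> exists2 i, (i < 20)%N & y = vec (node i).
Proof.
move=> Py yint; pose a i := Z_of_int (Num.floor (y 0 (inord i))).
have yE : y = vec [:: a 0%N; a 1%N; a 2%N; a 3%N; a 4%N].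
  apply/rowP => j; rewrite mxE.
  have -> : nth 0%Z [:: a 0%N; a 1%N; a 2%N; a 3%N; a 4%N] j = a j.
    by case: j => -[|[|[|[|[|]]]]].
  by rewrite /a inord_val /ZR Z_of_intK floorK// yint.
move: (a 0%N) (a 1%N) (a 2%N) (a 3%N) (a 4%N) yE => {}a b c d e yE.
move: Py; rewrite yE => /cayleyP[]; rewrite dot_zvec// -ZR1 => /ZR_inj y1 yf.
have yfZ f : f \in zfacets -> size f = 5 -> (0 <=? zdot f [:: a; b; c; d; e])%Z.
  by move=> /yf + f5; rewrite dot_zvec// ZR_ge0.
have := yfZ _ (mem_nth [::] (isT : (0 < size zfacets)%N)) erefl.
have := yfZ _ (mem_nth [::] (isT : (1 < size zfacets)%N)) erefl.
have := yfZ _ (mem_nth [::] (isT : (2 < size zfacets)%N)) erefl.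
have := yfZ _ (mem_nth [::] (isT : (3 < size zfacets)%N)) erefl.
have := yfZ _ (mem_nth [::] (isT : (4 < size zfacets)%N)) erefl.
have := yfZ _ (mem_nth [::] (isT : (5 < size zfacets)%N)) erefl.
move: y1; rewrite /zdot; cbn -[Z.mul Z.add Z.leb] => y1 f5 f4 f3 f2 f1 f0.
suff sP : [:: a; b; c; d; e] \in nodes.
  exists (index [:: a; b; c; d; e] nodes); first by move: sP; rewrite -index_mem.
  by rewrite /node nth_index.
have ab : (a = 0 /\ b = 1 \/ a = 1 /\ b = 0)%Z by lia.
have cC : (c = 0 \/ c = 1 \/ c = 2)%Z by lia.
have dC : (d = 0 \/ d = 1 \/ d = 2)%Z by lia.
have eC : (e = 0 \/ e = 1 \/ e = 2)%Z by lia.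
(* Of the 54 remaining candidates, 20 are nodes and each of the others violates the last
   inequality. *)
clear yf yfZ yE; move: y1 f5 f4 f3 f2 f1 f0.
by case: ab => -[-> ->]; case: cC => [|[]] ->; case: dC => [|[]] ->; case: eC => [|[]] ->.
Qed.

Local Notation pt i := (vec (node i)).

Lemma node_size i : (i < 20)%N -> size (node i) = 5.
Proof.
move=> i20; have: all (fun i => size (node i) == 5) (iota 0 20) by vm_compute.
by move=> /allP/(_ i); rewrite mem_iota => /(_ i20)/eqP.
Qed.

Lemma pt_inj i j : (i < 20)%N -> (j < 20)%N -> pt i = pt j -> i = j.
Proof.
move=> i20 j20 /(zvec_inj (node_size i20) (node_size j20)) /eqP.
by rewrite nth_uniq => // /eqP.
Qed.

Definition cell S : {fset 'rV[R]_(2 + 3)} := [fset pt i | i in S]%fset.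

Lemma cellP S p : reflect (exists2 i, i \in S & p = pt i) (p \in cell S).
Proof. exact: imfsetP. Qed.

Lemma mem_cell S i : all (gtn 20) S -> (i < 20)%N -> (pt i \in cell S) = (i \in S).
Proof.
move=> /allP S20 i20; apply/cellP/idP => [[j jS /pt_inj ->//]|iS]; last by exists i.
exact: S20.
Qed.

(** The enumeration order of a finite set of vectors is opaque; sums and cardinals are moved to the
    index list through this permutation. *)
Lemma perm_cell S : uniq S -> all (gtn 20) S -> perm_eq (cell S) (map (fun i => pt i) S).
Proof.
move=> uS /allP S20; apply: uniq_perm => [||p]; first exact: fset_uniq.
  by rewrite map_inj_in_uniq// => i j /S20 i20 /S20 j20; apply: pt_inj.
by apply/cellP/mapP => -[i iS ->]; exists i.
Qed.

Lemma cell_inj S S' :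
  well_formed S -> well_formed S' -> cell S = cell S' -> S = S'.
Proof.
move=> /and3P[_ sS S20] /and3P[_ sS' S'20] SS'.
apply: (irr_sorted_eq ltn_trans ltnn) => // i; apply/idP/idP => iS.
  by have i20 := allP S20 i iS; rewrite -(mem_cell S'20 i20) -SS' mem_cell.
by have i20 := allP S'20 i iS; rewrite -(mem_cell S20 i20) SS' mem_cell.
Qed.

(** A left inverse of [cell], through which functionals and dual bases computed from index lists
    become functions of the vertex set. *)
Definition indices (X : {fset 'rV[R]_(2 + 3)}) : seq nat :=
  [seq i <- iota 0 20 | pt i \in X].

Lemma cellK S : well_formed S -> indices (cell S) = S.
Proof.
move=> /and3P[_ sS S20]; apply: (irr_sorted_eq ltn_trans ltnn) => //.
  by apply: sorted_filter; [exact: ltn_trans|exact: iota_ltn_sorted].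
move=> i; rewrite mem_filter mem_iota /= add0n.
case: (ltnP i 20) => i20; first by rewrite mem_cell ?andbT.
by rewrite andbF; apply/esym/negbTE/negP => /(allP S20)/=; rewrite ltnNge i20.
Qed.

(** Duality says that one product of two square matrices is the identity; then so is the product in
    the other order, which is the expansion. *)
Lemma dual_span n (p D : 'I_n -> 'rV[R]_n) :
  (forall k j, dot (D k) (p j) = (k == j)%:R) ->
  forall x, x = \sum_k dot (D k) x *: p k.
Proof.
move=> Dp x; pose A := \matrix_k p k; pose B := \matrix_k D k.
have BA : B *m A^T = 1%:M.
  by apply/matrixP => k j; rewrite !mxE -Dp; apply: eq_bigr => i _; rewrite !mxE.
rewrite -[LHS]mulmx1 -[1%:M]trmx1 -(mulmx1C BA) trmx_mul trmxK mulmxA mulmx_sum_row.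
apply: eq_bigr => k _; rewrite rowK; congr (_ *: _).
by rewrite mxE; apply: eq_bigr => i _; rewrite !mxE mulrC.
Qed.

Section Cells.
Variables (w : seq nat) (T : seq (seq nat)).
Hypothesis T_ok : all (cell_ok w T) T.
Hypothesis T_neq0 : T != [::].

Definition complex : {fset {fset 'rV[R]_(2 + 3)}} := [fset cell S | S in T]%fset.

Lemma complexP X : reflect (exists2 S, S \in T & X = cell S) (X \in complex).
Proof. exact: imfsetP. Qed.

Lemma T_wf S : S \in T -> well_formed S.
Proof. by move=> /(allP T_ok)/and4P[]. Qed.

Lemma wf_lt S i : well_formed S -> i \in S -> (i < 20)%N.
Proof. by move=> /and3P[_ _ /allP S20] /S20. Qed.

Lemma wf_uniq S : well_formed S -> uniq S.
Proof. by move=> /and3P[_ sS _]; apply: (sorted_uniq ltn_trans ltnn). Qed.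

Lemma wf_mem S i : well_formed S -> (i < 20)%N -> (pt i \in cell S) = (i \in S).
Proof. by move=> /and3P[_ _ S20]; apply: mem_cell. Qed.

Definition lattice_points : {fset 'rV[R]_(2 + 3)} := cell (iota 0 20).

Lemma lattice_pointsP p : reflect (exists2 i, (i < 20)%N & p = pt i) (p \in lattice_points).
Proof.
by apply: (iffP (cellP _ _)) => -[i]; rewrite ?mem_iota => i20 ->; exists i;
  rewrite ?mem_iota.
Qed.

(** The height table as a function on vectors; its value away from the 20 nodes is arbitrary. *)
Definition rheight (p : 'rV[R]_(2 + 3)) : R :=
  ZR (height w (index p [seq pt i | i <- iota 0 20])).

Lemma rheightE i : (i < 20)%N -> rheight (pt i) = ZR (height w i).
Proof.
move=> i20; congr (ZR (height w _)).
have {1}-> : pt i = nth 0 [seq pt i | i <- iota 0 20] i.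
  by rewrite (nth_map 0%N) ?size_iota// nth_iota.
rewrite index_uniq ?size_map ?size_iota// map_inj_in_uniq ?iota_uniq//.
by move=> j k; rewrite !mem_iota; apply: pt_inj.
Qed.

Definition rfunctional X := vec (functional w (indices X)).

Definition rdual X p :=
  vec (nth [::] (dual_basis (indices X)) (index p [seq pt i | i <- indices X])).

Lemma dual_size S k : (k < 5)%N -> size (nth [::] (dual_basis S) k) = 5.
Proof. by case: k => [|[|[|[|[|]]]]]. Qed.

Lemma rfunctionalE S i : S \in T -> (i < 20)%N ->
  dot (rfunctional (cell S)) (pt i) = ZR (zdot (functional w S) (node i)).
Proof.
by move=> ST i20; rewrite /rfunctional cellK ?T_wf// dot_zvec.
Qed.

Lemma rdualE S k : S \in T -> (k < 5)%N ->
  rdual (cell S) (pt (nth 0%N S k)) = vec (nth [::] (dual_basis S) k).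
Proof.
move=> ST k5; have wS := T_wf ST; rewrite /rdual cellK//.
have /and3P[/eqP S5 _ _] := wS; congr (vec (nth _ _ _)).
rewrite -(nth_map _ 0 (fun i => pt i)) ?S5//.
rewrite index_uniq ?size_map ?S5//.
rewrite map_inj_in_uniq ?wf_uniq// => i j /(wf_lt wS) i20 /(wf_lt wS) j20.
exact: pt_inj.
Qed.

Lemma rdual_dual S k j : S \in T -> (k < 5)%N -> (j < 5)%N ->
  dot (rdual (cell S) (pt (nth 0%N S k))) (pt (nth 0%N S j)) = (k == j)%:R.
Proof.
move=> ST k5 j5; rewrite rdualE// dot_zvec ?dual_size//.
have /and4P[_ /allP/(_ k) + _ _] := allP T_ok S ST.
rewrite mem_iota => /(_ k5)/allP/(_ j); rewrite mem_iota => /(_ j5)/eqP ->.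
by case: eqP.
Qed.

Lemma cell_nth S p : S \in T -> p \in cell S ->
  exists2 k, (k < 5)%N & p = pt (nth 0%N S k).
Proof.
move=> ST /cellP[i iS ->]; have /and3P[/eqP S5 _ _] := T_wf ST.
by exists (index i S); rewrite ?nth_index// -S5 index_mem.
Qed.

Lemma lower_le S i : S \in T -> (i < 20)%N ->
  if i \in S then zdot (functional w S) (node i) == height w i
  else (zdot (functional w S) (node i) <? height w i)%Z.
Proof.
move=> ST i20; have /and4P[_ _ /allP/(_ i) + _] := allP T_ok S ST.
by rewrite mem_iota; apply.
Qed.

Lemma complex_regular_unimodular :
  [/\ triangulation P complex, regular P complex & unimodular P complex].
Proof.
have latP : P `&` integral = [set` lattice_points].
  apply/seteqP; split=> [y [Py yint]|_ /= /lattice_pointsP[i i20 ->]].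
    by apply/lattice_pointsP; apply: lattice_node.
  by split; [exact: node_P|exact: zvec_int].
have convP : conv [set` lattice_points] `<=` P.
  move=> y Vy; apply/cayleyP; split=> [|f ff].
    by apply: conv_eq Vy => _ /lattice_pointsP[i i20 ->]; case/cayleyP: (node_P i20).
  apply: conv_ge Vy => _ /lattice_pointsP[i i20 ->].
  by case/cayleyP: (node_P i20) => _; apply.
have hP y : P y -> dot (vec zlevel) y = 1 by case/cayleyP.
have T0 : complex != fset0.
  move: T_neq0; case E: T => [//|S T'] _; apply/fset0Pn; exists (cell S).
  by apply/complexP; exists S; rewrite ?E ?mem_head.
have Tsub X : X \in complex -> {subset X <= lattice_points}.
  move=> /complexP[S ST ->] p /cellP[i iS ->]; apply/lattice_pointsP; exists i => //.
  exact: wf_lt (T_wf ST) iS.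
have Tmiss X : X \in complex -> exists2 q, q \in lattice_points & q \notin X.
  move=> /complexP[S ST ->]; have wS := T_wf ST; have /and3P[/eqP S5 _ _] := wS.
  (* A cell uses only five of the twenty lattice points. *)
  have /allPn[i] : ~~ all (mem S) (iota 0 20).
    apply/negP => /allP /(uniq_leq_size (iota_uniq 0 20)).
    by rewrite size_iota S5.
  rewrite mem_iota => i20 iS; exists (pt i); first by apply/lattice_pointsP; exists i.
  by rewrite wf_mem.
have ule X p : X \in complex -> p \in lattice_points ->
    dot (rfunctional X) p <= rheight p.
  move=> /complexP[S ST ->] /lattice_pointsP[i i20 ->].
  rewrite rfunctionalE// rheightE//; have := lower_le ST i20.
  by case: (i \in S) => [/eqP ->//|]; rewrite -ZR_lt => /ltW.
have ueq X p : X \in complex -> p \in lattice_points ->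
    (dot (rfunctional X) p == rheight p) = (p \in X).
  move=> /complexP[S ST ->] /lattice_pointsP[i i20 ->].
  rewrite rfunctionalE// rheightE// wf_mem ?T_wf//; have := lower_le ST i20.
  by case: (i \in S) => [/eqP ->|]; rewrite ?eqxx// -ZR_lt => /lt_eqF.
have ldual X p q : X \in complex -> p \in X -> q \in X ->
    dot (rdual X p) q = (p == q)%:R.
  move=> /complexP[S ST ->] /(cell_nth ST)[k k5 ->] /(cell_nth ST)[j j5 ->].
  rewrite rdual_dual//; congr (_%:R); have wS := T_wf ST.
  have /and3P[/eqP S5 _ _] := wS; have nS l : (l < 5)%N -> (nth 0%N S l < 20)%N.
    by move=> l5; apply: (wf_lt wS); rewrite mem_nth ?S5.
  rewrite -(nth_uniq 0%N _ _ (wf_uniq wS)) ?S5//; congr nat_of_bool.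
  by apply/eqP/eqP => [->//|]; apply: pt_inj; apply: nS.
have lspan X x : X \in complex -> x = \sum_(p <- X) dot (rdual X p) x *: p.
  move=> /complexP[S ST ->]; have wS := T_wf ST; have /and3P[/eqP S5 _ S20] := wS.
  rewrite (perm_big _ (perm_cell (wf_uniq wS) S20)) big_map (big_nth 0%N) S5 big_mkord.
  apply: (@dual_span 5 (fun k => pt (nth 0%N S k))
    (fun k => rdual (cell S) (pt (nth 0%N S k)))) => k j.
  by rewrite rdual_dual.
have lint X p x : X \in complex -> p \in X -> integral x ->
    dot (rdual X p) x \is a Num.int.
  move=> _ _ xint; apply: rpred_sum => i _.
  by rewrite rpredM ?mxE ?ZR_int.
have Tfacet X p : X \in complex -> p \in X ->
  (exists f, [/\ forall x, P x -> 0 <= dot f x, 0 < dot f p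
                & {in X, forall q, q != p -> dot f q = 0}]) \/
  (exists2 X', X' \in complex & X' != X /\ {in X, forall q, q != p -> q \in X'}).
  move=> /complexP[S ST ->] /cellP[i iS ->]; have wS := T_wf ST.
  have i20 := wf_lt wS iS.
  have /and4P[_ _ _ /allP/(_ i iS)/orP[]] := allP T_ok S ST.
    move=> /hasP[f ff /andP[/allP f0 fi]]; left; exists (vec f).
    have f5 : size f = 5.
      have: all (fun f => size f == 5) zfacets by vm_compute.
      by move=> /allP/(_ f ff)/eqP.
    split=> [x /cayleyP[_]||_ /cellP[j jS ->] ji]; first exact.
      by rewrite dot_zvec// ZR_gt0.
    rewrite dot_zvec// (eqP (f0 j _)) ?ZR0// mem_filter jS andbT.
    by apply: contraNneq ji => ->.
  move=> /hasP[S' S'T /andP[S'S /allP F]]; right; exists (cell S').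
    by apply/complexP; exists S'.
  split=> [|_ /cellP[j jS ->] ji].
    by apply: contraNneq S'S => /cell_inj -> //; apply: T_wf.
  apply/cellP; exists j => //; apply: F; rewrite mem_filter jS andbT.
  by apply: contraNneq ji => ->.
split.
- exact: (certificate_triangulation latP convP hP T0 Tsub ule ueq ldual lspan Tfacet).
- exact: (certificate_regular latP convP hP T0 Tsub Tmiss ule ueq lspan Tfacet).
- exact: (certificate_unimodular latP hP T0 Tsub Tmiss ldual lspan lint).
Qed.

(** * The tropical graph in terms of index lists *)

Lemma sub_wf S (s : seq nat) : well_formed S -> subseq s S -> uniq s /\ all (gtn 20) s.
Proof.
move=> wS sS; split; first exact: subseq_uniq sS (wf_uniq wS).
by apply/allP => i /(mem_subseq sS) /(wf_lt wS).
Qed.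

Lemma card_cell (s : seq nat) : uniq s -> all (gtn 20) s -> #|` cell s| = size s.
Proof. by move=> us s20; rewrite (perm_size (perm_cell us s20)) size_map. Qed.

Lemma cellI S S' : well_formed S -> well_formed S' ->
  (cell S `&` cell S')%fset = cell [seq i <- S | i \in S'].
Proof.
move=> wS wS'; apply/fsetP => p; rewrite in_fsetI; apply/andP/cellP.
  move=> [/cellP[i iS ->]]; rewrite wf_mem ?(wf_lt wS iS)// => iS'.
  by exists i => //; rewrite mem_filter iS'.
by move=> [i]; rewrite mem_filter => /andP[iS' iS] ->; split; apply/cellP; exists i.
Qed.

Lemma lsub_node i : (i < 20)%N ->
  lsubmx (pt i) = delta_mx 0 (if (i < 10)%N then ord0 else ord_max).
Proof.
move=> i20; have: all (fun i => take 2 (node i) ==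
    if (i < 10)%N then [:: 1; 0]%Z else [:: 0; 1]%Z) (iota 0 20) by vm_compute.
move=> /allP/(_ i); rewrite mem_iota => /(_ i20)/eqP ni.
apply/rowP => j; rewrite !mxE -(nth_take _ (ltn_ord j)) ni.
by case: ifP => _; case: j => -[|[|]].
Qed.

Lemma side_cell b (s : seq nat) : uniq s -> all (gtn 20) s ->
  side b (cell s) = cell [seq i <- s | (i < 10)%N == (b == ord0)].
Proof.
move=> us /allP s20; apply/fsetP => p.
have sideE i : i \in s ->
    (lsubmx (pt i) == delta_mx 0 b) = ((i < 10)%N == (b == ord0)).
  move=> /s20 i20; rewrite lsub_node//.
  have dE (k l : 'I_2) : (delta_mx 0 k == delta_mx 0 l :> 'rV[R]_2) = (k == l).
    apply/eqP/eqP => [/rowP/(_ k)|->//]; rewrite !mxE !eqxx /=.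
    by case: eqP => // _ /eqP; rewrite oner_eq0.
  by rewrite dE; case: ifP => _; case: (unliftP ord0 b) => [j ->|->] //;
    rewrite (ord1 j).
rewrite !inE; apply/andP/cellP => [[/cellP[i iS ->]]|[i]].
  by rewrite sideE// => ib; exists i => //; rewrite mem_filter ib.
rewrite mem_filter => /andP[ib iS] ->; split; first by apply/cellP; exists i.
by rewrite /= sideE.
Qed.

Lemma card_side0 (s : seq nat) : uniq s -> all (gtn 20) s ->
  #|` side ord0 (cell s)| = count (gtn 10) s.
Proof.
move=> us s20; rewrite side_cell// card_cell ?filter_uniq//.
  by rewrite size_filter; apply: eq_count => i; rewrite eqxx eqb_id.
by apply/allP => i; rewrite mem_filter => /andP[_ /(allP s20)].
Qed.

Lemma card_side1 (s : seq nat) : uniq s -> all (gtn 20) s ->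
  #|` side ord_max (cell s)| = (size s - count (gtn 10) s)%N.
Proof.
move=> us s20; rewrite side_cell// card_cell ?filter_uniq//.
  rewrite size_filter -(count_predC (gtn 10) s) addKn.
  by apply: eq_count => i /=; rewrite eqbF_neg.
by apply/allP => i; rewrite mem_filter => /andP[_ /(allP s20)].
Qed.

Lemma tropical_graph_cell S S' : S \in T -> S' \in T ->
  tropical_graph complex (cell S) (cell S') = index_adjacent S S'.
Proof.
move=> ST S'T; have [wS wS'] := (T_wf ST, T_wf S'T).
have /and3P[/eqP S5 _ S20] := wS; have /and3P[/eqP S'5 _ S'20] := wS'.
have [uS uS'] := (wf_uniq wS, wf_uniq wS').
have CS : cell S \in complex by apply/complexP; exists S.
have CS' : cell S' \in complex by apply/complexP; exists S'.
have SS' : (cell S == cell S') = (S == S').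
  by apply/eqP/eqP => [|->//]; apply: cell_inj.
have [uF F20] := sub_wf wS (filter_subseq (mem S') S).
rewrite /tropical_graph /index_adjacent /mixed /index_mixed !card_side0// CS CS' SS' /=.
congr [&& _, _, _ & _].
rewrite /share_quadrilateral /simplex_facet fsubsetIl fsubsetIr /= cellI//.
rewrite !card_cell// S5 S'5 card_side0// card_side1// !eqSS.
(* Among four common vertices, two in the first copy leave exactly two in the second, so
   [index_adjacent] counts only one side. *)
case: (eqVneq (size [seq i <- S | i \in S']) 4) => [->|//].
by rewrite /=; case: eqP => // ->.
Qed.

Lemma tropical_graph_sym : symmetric (tropical_graph complex).
Proof.
move=> X Y; rewrite /tropical_graph /share_quadrilateral fsetIC eq_sym.
by apply/and5P/and5P => -[-> -> -> -> /andP[-> /and4P[-> -> -> ->]]].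
Qed.

Lemma tropical_graph_mem X Y : tropical_graph complex X Y -> X \in complex.
Proof. by case/andP. Qed.

Lemma pruning_map (c t : seq (seq nat)) : {subset c <= T} -> {subset t <= T} ->
  pruning (tropical_graph complex) (map cell c) (map cell t) =
  pruning index_adjacent c t.
Proof.
elim: t c => [//|S t IH] c cT tT /=.
have ST : S \in T by apply: tT; rewrite mem_head.
rewrite count_map -map_rcons IH.
- congr ((_ <= _)%N && _); apply: eq_in_count => S' /cT S'T /=.
  exact: tropical_graph_cell.
- by move=> S'; rewrite mem_rcons inE => /orP[/eqP->|/cT].
- by move=> S' S't; apply: tT; rewrite inE S't orbT.
Qed.

Lemma complex_cycle n : (3 <= n)%N -> graph_ok n T ->
  unique_cycle_of_length (tropical_graph complex) n.
Proof.
move=> n3 /and5P[uT /eqP sn cyc /allP deg pr].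
have cT : {subset take n T <= T} by move=> S; apply: mem_take.
have tT : {subset drop n T <= T} by move=> S; apply: mem_drop.
have tgE : {in take n T &, forall S S',
    tropical_graph complex (cell S) (cell S') = index_adjacent S S'}.
  by move=> S S' /cT ST /cT S'T; apply: tropical_graph_cell.
rewrite -sn -(size_map cell); apply: (unique_cycle (t := map cell (drop n T))).
- exact: tropical_graph_sym.
- move=> X Y /tropical_graph_mem /complexP[S ST ->].
  by rewrite -map_cat cat_take_drop map_f.
- split; first by rewrite size_map sn.
  apply/andP; split; last first.
    rewrite map_inj_in_uniq ?take_uniq// => S S' /cT/T_wf wS /cT/T_wf wS'.
    exact: cell_inj.
  rewrite (homo_cycle_in (P := mem (take n T)) (e := index_adjacent)) //.
  by move=> S S' Sc S'c; rewrite tgE.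
- move=> _ /mapP[S Sc ->]; rewrite count_map.
  rewrite (@eq_in_count _ _ (index_adjacent S)) ?deg// => S' S'c /=.
  by rewrite tgE.
- by rewrite pruning_map.
Qed.

End Cells.
End Realization.

Theorem corollary4p5 (R : realType) (n : nat) :
  (3 <= n <= 16)%N ->
  let P : set 'rV[R]_(2 + 3) :=
    cayley (dilated_simplex 2 3) (dilated_simplex 2 3) in
  exists T : {fset {fset 'rV[R]_(2 + 3)}},
    [/\ triangulation P T, regular P T, unimodular P T
      & unique_cycle_of_length (tropical_graph T) n].
Proof.
move=> /andP[n3 n16] P.
have /allP/(_ n) := certificates_ok; rewrite mem_iota n3 => /(_ n16)/andP[].
set C := nth _ _ _ => T_ok G_ok; exists (complex C.2).
have T0 : C.2 != [::].
  by apply: contraTneq n3 => T0; have /and3P[_ /eqP <- _] := G_ok; rewrite T0.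
have [tri reg uni] := complex_regular_unimodular T_ok T0 (R := R).
by split=> //; apply: complex_cycle T_ok n n3 G_ok.
Qed.
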